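(* Let $1\le p,q,r<\infty$ and let $\vartheta_1,\vartheta_2,\vartheta_3,\vartheta_4$ be Beurling weights on $\mathbb R^d$. The embedding of $A^{p,1,q,r}_{\vartheta_1,\vartheta_2}(\mathbb R^d)$ into $A^{p,1,q,r}_{\vartheta_3,\vartheta_4}(\mathbb R^d)$ is never compact (i.e. the inclusion map is not a compact operator) if (i) $\vartheta_4\prec\vartheta_2\prec\vartheta_1$, $\vartheta_3\prec\vartheta_1$ and $\frac{\vartheta_3(x)}{\vartheta_1(x)}$ does not tend to zero in $\mathbb R^d$ as $x\to\infty$, or (ii) $\vartheta_3\prec\vartheta_1\prec\vartheta_2$, $\vartheta_4\prec\vartheta_2$ and $\frac{\vartheta_3(x)}{\vartheta_2(x)}$ does not tend to zero in $\mathbb R^d$ as $x\to\infty$.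
   Context: A Beurling weight on $\mathbb R^d$ is a measurable, locally integrable function $\vartheta:\mathbb R^d\to(0,\infty)$ with $\vartheta(x)\ge1$ and $\vartheta(x+y)\le\vartheta(x)\vartheta(y)$ for all $x,y$. $\vartheta\prec\vartheta'$ means there is $C>0$ with $\vartheta(x)\le C\vartheta'(x)$ for all $x$. For $1\le p,q<\infty$ and $\alpha\in\mathbb Z^d$ put $I_\alpha=\alpha+[0,1)^d$, $\|f\|_{pq}=\big(\sum_{\alpha\in\mathbb Z^d}\|f\|_{L^p(I_\alpha)}^q\big)^{1/q}$ (Lebesgue measure). $(L^p_\vartheta,\ell^q)$ is the space of $f\in L^p_{loc}(\mathbb R^d)$ (mod a.e. equality) with $\|f\|_{pq,\vartheta}:=\|f\vartheta\|_{pq}<\infty$. $\widehat f$ is the Fourier transform on $\mathbb R^d$, with $\widehat{\mathbb R^d}$ identified with $\mathbb R^d$. For Beurling weights $\vartheta,\omega$ on $\mathbb R^d$, $A^{p,1,q,r}_{\vartheta,\omega}(\mathbb R^d)=\{f\in(L^p_{\vartheta},\ell^1):\widehat f\in(L^q_{\omega},\ell^r)\}$ with norm $\|f\|^{p,1,q,r}_{\vartheta,\omega}=\|f\|_{p1,\vartheta}+\|\widehat f\|_{qr,\omega}$. *)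

(* Defs.v *)
From HB Require Import structures.
From mathcomp Require Import all_boot all_order all_algebra.
From mathcomp Require Import all_classical all_reals all_analysis.
From mathcomp.real_closed Require Import complex.

Set Implicit Arguments.
Unset Strict Implicit.
Unset Printing Implicit Defensive.

Import Order.TTheory GRing.Theory Num.Theory.
Import numFieldNormedType.Exports.

Local Open Scope classical_set_scope.
Local Open Scope ring_scope.

(* Borel sets of R^d, realised as 'rV[R]_d: generated by the coordinates. *)
Section borel_rV.
Context {R : realType} (d : nat).

Let coord (i : 'I_d) (x : 'rV[R]_d) : measurableTypeR R := x ord0 i.

Let rV_set0 : g_sigma_preimage coord set0.
Proof. exact: sigma_algebra0. Qed.

Let rV_setC A : g_sigma_preimage coord A -> g_sigma_preimage coord (~` A).
Proof. exact: sigma_algebraC. Qed.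

Let rV_bigcup (F : (set 'rV[R]_d)^nat) :
  (forall i, g_sigma_preimage coord (F i)) ->
  g_sigma_preimage coord (\bigcup_i (F i)).
Proof. exact: sigma_algebra_bigcup. Qed.

HB.instance Definition _ := @isMeasurable.Build default_measure_display
  'rV[R]_d (g_sigma_preimage coord) rV_set0 rV_setC rV_bigcup.

Lemma measurable_coord_rV (i : 'I_d) :
  measurable_fun [set: 'rV[R]_d]
    ((fun x => x ord0 i) : 'rV[R]_d -> measurableTypeR R).
Proof.
move=> _ Y mY; rewrite setTI; apply: sub_sigma_algebra => /=.
rewrite -bigcup_seq/=; exists i => /=; first by rewrite mem_index_enum.
by exists Y => //; rewrite setTI.
Qed.

Lemma measurable_fun_rV d1 (T : measurableType d1) (f : T -> 'rV[R]_d) :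
  (forall i, measurable_fun [set: T]
     ((fun t => f t ord0 i) : T -> measurableTypeR R)) ->
  measurable_fun [set: T] f.
Proof.
move=> mf _ A mA; rewrite setTI.
suff: g_sigma_preimage coord `<=` [set B | measurable (f @^-1` B)] by exact.
apply: smallest_sub.
  split => /=.
  - by rewrite preimage_set0.
  - by move=> B mB; rewrite setTD preimage_setC; exact: measurableC.
  - by move=> F mF; rewrite preimage_bigcup; exact: bigcupT_measurable.
rewrite -bigcup_seq; apply: bigcup_sub => i _ B [C mC <-] /=.
by have := mf i measurableT C mC; rewrite !setTI.
Qed.

End borel_rV.

Section lebesgue_rV.
Context {R : realType}.

Definition cons_rV (d : nat) (z : measurableTypeR R * 'rV[R]_d) : 'rV[R]_d.+1 :=
  \row_i (if unlift ord0 i is Some j then z.2 ord0 j else z.1).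

Definition uncons_rV (d : nat) (x : 'rV[R]_d.+1) :
    measurableTypeR R * 'rV[R]_d :=
  (x ord0 ord0, \row_j x ord0 (lift ord0 j)).

Lemma cons_rVK d : cancel (@cons_rV d) (@uncons_rV d).
Proof.
move=> [a v]; rewrite /uncons_rV /cons_rV mxE unlift_none; congr (_, _).
by apply/rowP => j; rewrite !mxE liftK.
Qed.

Lemma measurable_cons_rV d : measurable_fun setT (@cons_rV d).
Proof.
apply: measurable_fun_rV => i; rewrite /cons_rV.
case: (unliftP ord0 i) => [j ->|->].
  under eq_fun do rewrite mxE liftK.
  exact: (measurableT_comp (measurable_coord_rV j) measurable_snd).
under eq_fun do rewrite mxE unlift_none.
exact: measurable_fst.
Qed.

Lemma measurable_uncons_rV d : measurable_fun setT (@uncons_rV d).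
Proof.
apply: measurable_fun_pair; first exact: measurable_coord_rV.
apply: measurable_fun_rV => j; under eq_fun do rewrite mxE.
exact: measurable_coord_rV.
Qed.

Section push_cons.
Context (d : nat) (mu : {sigma_finite_measure set 'rV[R]_d -> \bar R}).
Local Open Scope ereal_scope.

Definition push_cons : set 'rV[R]_d.+1 -> \bar R :=
  pushforward (@lebesgue_measure R \x mu) (@cons_rV d).

Let push_cons0 : push_cons set0 = 0.
Proof. by rewrite /push_cons /pushforward preimage_set0 measure0. Qed.

Let push_cons_ge0 A : 0 <= push_cons A.
Proof. by rewrite /push_cons /pushforward; exact: measure_ge0. Qed.

Let push_cons_sigma_additive : semi_sigma_additive push_cons.
Proof.
move=> F mF tF mUF; rewrite /push_cons /pushforward preimage_bigcup.
apply: measure_semi_sigma_additive.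
- by move=> n; rewrite -[X in measurable X]setTI; exact: measurable_cons_rV.
- apply/trivIsetP => /= i j _ _ ij; rewrite -preimage_setI.
  by move/trivIsetP : tF => /(_ i j Logic.I Logic.I ij) ->; rewrite preimage_set0.
- rewrite -preimage_bigcup -[X in measurable X]setTI.
  exact: measurable_cons_rV.
Qed.

HB.instance Definition _ := isMeasure.Build _ _ _ push_cons
  push_cons0 push_cons_ge0 push_cons_sigma_additive.

Let push_cons_sigma_finite : sigma_finite setT push_cons.
Proof.
have /sigma_finiteP[A [TA ndA Aoo]] := sigma_finiteT (@lebesgue_measure R).
have /sigma_finiteP[B [TB ndB Boo]] := sigma_finiteT mu.
exists (fun n => @uncons_rV d @^-1` (A n `*` B n)).
  rewrite -preimage_bigcup; apply/esym/seteqP; split => // x _.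
  have [i _ Ai] : (\bigcup_n A n) (uncons_rV x).1 by rewrite -TA.
  have [j _ Bj] : (\bigcup_n B n) (uncons_rV x).2 by rewrite -TB.
  exists (maxn i j) => //; split => /=.
  - by move: Ai; apply/subsetPset/ndA/leq_maxl.
  - by move: Bj; apply/subsetPset/ndB/leq_maxr.
move=> n; have [mAn Anoo] := Aoo n; have [mBn Bnoo] := Boo n; split.
  rewrite -[X in measurable X]setTI; apply: measurable_uncons_rV => //.
  exact: measurableX.
rewrite /push_cons /pushforward -comp_preimage.
rewrite (_ : _ \o _ = id) ?preimage_id; last by apply/funext=> z; exact: cons_rVK.
by rewrite product_measure1E// lte_mul_pinfty// ge0_fin_numE.
Qed.

HB.instance Definition _ := Measure_isSigmaFinite.Build _ _ _ push_cons
  push_cons_sigma_finite.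

End push_cons.

Fixpoint borel_lebesgue_rV (d : nat) :
    {sigma_finite_measure set 'rV[R]_d -> \bar R} :=
  if d is d'.+1 then push_cons (borel_lebesgue_rV d') else \d_(0 : 'rV[R]_0).

End lebesgue_rV.
Arguments borel_lebesgue_rV R d : clear implicits.

(* The points of R^d with the sigma-algebra of Lebesgue measurable sets. *)
Definition euclidean (R : realType) (d : nat) : Type :=
  caratheodory_type (borel_lebesgue_rV R d)^*%mu.
HB.instance Definition _ R d := Measurable.on (euclidean R d).

Definition lebesgue_rV (R : realType) (d : nat) :
    {measure set (euclidean R d) -> \bar R} :=
  @completed_measure_extension _ _ R (borel_lebesgue_rV R d).

Section amalgam_spaces.
Context {R : realType} {d : nat}.
Implicit Types (f : 'rV[R]_d -> R[i]) (w : 'rV[R]_d -> R) (p q r : R).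

Local Notation mu := (lebesgue_rV R d).

Definition lebesgue_measurable (g : 'rV[R]_d -> R) :=
  measurable_fun [set: euclidean R d] (g : euclidean R d -> R).

Definition beurling_weight w := [/\
  lebesgue_measurable w,
  forall K : set 'rV[R]_d, compact K -> (\int[mu]_(x in K) (w x)%:E < +oo)%E,
  forall x, 1 <= w x &
  forall x y, w (x + y) <= w x * w y].

Definition weight_le w w' := exists2 C : R, 0 < C & forall x, w x <= C * w' x.

(* The complements of balls; the sup norm of 'rV[R]_d is equivalent to the
   Euclidean norm. *)
Definition nbhs_infinity : set_system 'rV[R]_d :=
  [set A | exists M : R, forall x, M < `|x| -> A x].

Definition modulus f (x : euclidean R d) : \bar R :=
  (ComplexField.Normc.normc (f x))%:E.

Definition complex_measurable f :=
  lebesgue_measurable (fun x => complex.Re (f x)) /\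
  lebesgue_measurable (fun x => complex.Im (f x)).

(* Elements of L^p_loc are represented by functions; the functionals below
   depend only on the class modulo a.e. equality. *)
Definition Lp_loc p f :=
  complex_measurable f /\
  forall K : set 'rV[R]_d, compact K -> ('N[mu]_p%:E[modulus f \_ K] < +oo)%E.

Definition cube (a : 'rV[int]_d) : set 'rV[R]_d :=
  [set x | forall i, (a ord0 i)%:~R <= x ord0 i < (a ord0 i)%:~R + 1].

Definition amalgam_norm p q f : \bar R :=
  ((\esum_(a in [set: 'rV[int]_d])
     'N[mu]_p%:E[modulus f \_ (cube a)] `^ q) `^ q^-1)%E.

Definition weighted_amalgam_norm p q w f : \bar R :=
  amalgam_norm p q (fun x => f x * real_complex R (w x)).

Definition weighted_amalgam p q w : set ('rV[R]_d -> R[i]) :=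
  [set f | Lp_loc p f /\ (weighted_amalgam_norm p q w f < +oo)%E].

Definition complex_integral f : R[i] :=
  Complex (\int[mu]_x complex.Re (f x)) (\int[mu]_x complex.Im (f x)).

Definition dotv (x y : 'rV[R]_d) : R := \sum_(i < d) x ord0 i * y ord0 i.

(* Normalisation: exp(- 2 pi i x.xi), so that Lebesgue measure is its own
   dual Haar measure. *)
Definition fourier f (xi : 'rV[R]_d) : R[i] :=
  complex_integral (fun x => f x *
    Complex (cos (2 * pi * dotv x xi)) (- sin (2 * pi * dotv x xi))).

Definition A_space p q r w1 w2 : set ('rV[R]_d -> R[i]) :=
  [set f | weighted_amalgam p 1 w1 f /\ weighted_amalgam q r w2 (fourier f)].

Definition A_norm p q r w1 w2 f : \bar R :=
  (weighted_amalgam_norm p 1 w1 f + weighted_amalgam_norm q r w2 (fourier f))%E.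

End amalgam_spaces.

(* For X `<=` Y: the inclusion of (X, nX) into (Y, nY) is a compact operator,
   i.e. every nX-bounded sequence of X has a subsequence that converges in Y. *)
Definition compact_inclusion (R : realType) (V : zmodType) (X Y : set V)
    (nX nY : V -> \bar R) :=
  forall u : V^nat, (forall n, X (u n)) ->
  (exists M : R, forall n, (nX (u n) <= M%:E)%E) ->
  exists2 k : nat -> nat, {homo k : m n / (m < n)%N} &
  exists2 g, Y g & nY (u (k n) - g) @[n --> \oo] --> 0%E.

(* Main.v *)
Require Import Defs.
From mathcomp Require Import all_boot all_order all_algebra.
From mathcomp Require Import all_classical all_reals all_analysis.
From mathcomp.real_closed Require Import complex.
From mathcomp Require Import measurable_realfun ring lra.

Set Implicit Arguments.
Unset Strict Implicit.
Unset Printing Implicit Defensive.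

Import Order.TTheory GRing.Theory Num.Theory.
Import numFieldNormedType.Exports.

Local Open Scope classical_set_scope.
Local Open Scope ring_scope.

(** The inclusion holds because enlarging a weight shrinks the amalgam space
    ([A_space_sub]).  For the lack of compactness, the second case reduces to the
    first one: there w1 is dominated by w2, so that w3 / w1 is at least a constant
    times w3 / w2 and cannot tend to zero either.

    Suppose that w3 / w1 stays above some e > 0 along points that go to
    infinity.  A Beurling weight is bounded on the unit ball, hence it varies by
    at most a bounded factor over distances at most 1, and the points may be
    rounded to pairwise distinct points a_n of the integer lattice
    ([lattice_escape]).  With G the Gaussian exp (- |x|^2), for the
    Euclidean norm, put
<<
      u_n (x) = G (x - a_n) / w1 (a_n).
>>
    - The sequence is bounded in the source space ([gauss_wave_bounded]).
      Indeed w1 (x) <= w1 (a_n) * w1 (x - a_n), so that u_n * w1 is dominated by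
      the translate by a_n of G * w1; as a_n is a lattice point, translating
      only permutes the unit cubes.  The Fourier transform of u_n is a
      modulation of a fixed Gaussian divided by w1 (a_n) >= 1, so its weighted
      norm is bounded too.  Both bounds need a function which, together with its
      Fourier transform, decays faster than any exponential, because Beurling
      weights may grow exponentially, though not faster ([weight_exp_bound]);
      this is why Gaussians are used.
    - The mass of u_n does not disappear in the target space: the L^p norm of
      u_n * w3 over the unit cube at a_n is at least some c > 0 which does not
      depend on n ([gauss_wave_cube_ge]).

    If a subsequence of u_n converged to g, then by the triangle inequality the
    L^p norm of g * w3 over the cube at a_n would be at least c / 2 for
    infinitely many n.  These cubes are pairwise distinct, so the sum of all the
    L^p norms of g * w3 over unit cubes would be infinite, and g would not
    belong to the target space ([not_compact_of_escape]).

    The ingredients are the Fourier transform of the Gaussian, obtained in one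
    dimension from a differential equation ([Rintegral_gauss_cos]) and
    transferred to d dimensions by Fubini ([fourier_gauss_rV]), and the
    boundedness of a measurable submultiplicative function on the unit ball, by
    an argument of Steinhaus type ([weight_unit_bounded]). *)

(** * Reflections and derivatives on the real line *)

Section line.
Context {R : realType}.
Local Notation leb := (@lebesgue_measure R).

Let refl (c : R) : measurableTypeR R -> measurableTypeR R := fun x => c - x.

Let measurable_refl (c : R) : measurable_fun setT (refl c).
Proof. by apply: measurable_funB. Qed.

(** Reflections are used rather than translations because a single map
    x |-> c - x serves three purposes: it translates the Gaussian, which is
    even, it kills the integrals of odd functions, and it is the symmetry that the
    boundedness of Beurling weights calls for. *)
Lemma lebesgue_measure_reflection (c : R) (A : set R) : measurable A ->
  pushforward leb (refl c) A = leb A.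
Proof.
have mf := measurable_refl c.
move=> mA; apply/esym/lebesgue_measure_unique => //= _ [[a b]] _ <-.
rewrite /pushforward (_ : _ @^-1` _ = `[c - b, c - a[%classic); last first.
  by apply/seteqP; split=> x /=; rewrite /refl !in_itv/= => /andP[? ?];
    apply/andP; split; lra.
rewrite !lebesgue_measure_itv/= !lte_fin ltrD2l ltrN2.
by case: ifP => // _; congr (_%:E); ring.
Qed.

Lemma integrable_reflection (c : R) (f : R -> R) :
  leb.-integrable setT (EFin \o f) ->
  leb.-integrable setT (fun x => (f (c - x))%:E).
Proof.
move=> /integrableP[mf foo].
have mr := measurable_refl c.
apply/integrableP; split.
  by apply: (measurableT_comp mf).
move: foo; apply: le_lt_trans.
rewrite -[leLHS](@ge0_integral_pushforward _ _ _ _ _ _ mr leb setT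
  (fun x => `|(f x)%:E|%E))//; last first.
  by apply: measurableT_comp => //.
rewrite [leLHS](_ : _ = \int[leb]_y `|(f y)%:E|)%E//.
by apply: eq_measure_integral => A mA _; exact: lebesgue_measure_reflection.
Qed.

Lemma Rintegral_reflection (c : R) (f : R -> R) :
  leb.-integrable setT (EFin \o f) ->
  \int[leb]_x f (c - x) = \int[leb]_x f x.
Proof.
move=> intf.
have mr := measurable_refl c.
have [mf foo] := integrableP _ _ _ intf.
rewrite /Rintegral; congr fine.
rewrite -[LHS](@integral_pushforward _ _ _ _ _ _ mr leb setT (EFin \o f))//; last first.
  exact: (integrable_reflection c intf).
by apply: eq_measure_integral => A mA _; exact: lebesgue_measure_reflection.
Qed.

(** The integrals over [-n, n] are F n - F (- n) by the fundamental theorem of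
    calculus, and they tend to the integral over the line by dominated
    convergence. *)
Lemma Rintegral_derivative (F f : R -> R) :
  continuous f -> (forall x, is_derive x (1 : R) F (f x)) ->
  leb.-integrable setT (EFin \o f) ->
  F n%:R @[n --> \oo] --> 0 -> F (- n%:R) @[n --> \oo] --> 0 ->
  \int[leb]_x f x = 0.
Proof.
move=> cf dF intf F1 F2.
have [mf _] := integrableP _ _ _ intf.
pose f_ n x := (f \_ `[- n%:R, n%:R] x)%:E.
have mf_ n : measurable_fun setT (f_ n).
  apply/measurable_EFinP.
  apply: (measurable_restrictT f (measurable_itv `[- n%:R, n%:R])).1.
  by apply: measurable_funTS; move/measurable_EFinP : mf.
have /= [] := @dominated_convergence _ _ _ leb setT measurableT f_ (EFin \o f)
  (fun x => `|f x|%:E) mf_ mf.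
- apply: aeW => x _; apply: cvg_near_cst.
  near=> n; rewrite /f_ patchE mem_set//=.
  rewrite in_itv/= -ler_norml.
  by near: n; exact: nbhs_infty_ger.
- exact: (integrable_norm intf).
- apply: aeW => x n _; rewrite /f_ patchE; case: ifP => //=.
  by rewrite normr0 lee_fin.
move=> _ _ cv.
have fin : (\int[leb]_x (f x)%:E)%E \is a fin_num by exact: integrable_fin_num.
have cv0 : (\int[leb]_x (f_ n x))%E @[n --> \oo] --> (0%:E : \bar R).
  apply: (@cvg_trans _ ((F n%:R - F (- n%:R))%:E @[n --> \oo])); last first.
    apply/cvg_EFin; first exact: nearW.
    by have := cvgB F1 F2; rewrite subr0; exact.
  apply: near_eq_cvg; near=> n.
  transitivity (\int[leb]_(x in `[(- n%:R)%R, n%:R%R]) (f x)%:E)%E; last first.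
    by rewrite integral_mkcond; apply: eq_integral => x _;
      rewrite /f_ !patchE; case: ifP.
  rewrite (@continuous_FTC2 _ f F).
  - by rewrite EFinB.
  - rewrite gtrN // ltr0n; near: n; exact: nbhs_infty_gt.
  - by apply: continuous_subspaceT.
  - have cF x : {for x, continuous F}.
      apply: differentiable_continuous; apply/derivable1_diffP.
      by have := dF x.
    split.
    + by move=> x _; have := dF x.
    + exact/cvg_at_right_filter/cF.
    + exact/cvg_at_left_filter/cF.
  - by move=> x _; rewrite derive1E; apply: derive_val.
have := cvg_unique _ cv cv0.
by rewrite /Rintegral => ->.
Unshelve. all: end_near. Qed.

Lemma integrable_mul_bounded (f h : R -> R) :
  leb.-integrable setT (EFin \o f) -> measurable_fun setT h ->
  (forall x, `|h x| <= 1) -> leb.-integrable setT (fun x => (f x * h x)%:E).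
Proof.
move=> intf mh h1; have [mf _] := integrableP _ _ _ intf.
apply: (le_integrable _ _ _ intf) => //.
  by apply/measurable_EFinP/measurable_funM => //; apply/measurable_EFinP.
by move=> x _; rewrite !abse_EFin lee_fin normrM ler_piMr.
Qed.

(** This is the dominating function for differentiating the Fourier integral of
    the Gaussian.  As |x| <= 1 + x^2 / 2 <= exp (x^2 / 2), it lies below
    exp (- x^2 / 2), the density of the standard normal law up to a constant. *)
Lemma integrable_mul_gauss :
  leb.-integrable setT (fun x : R => (`|x| * gauss_fun x)%:E).
Proof.
pose p : R := normal_peak 1.
have p0 : 0 < p by apply: normal_peak_gt0.
have := @integrableZl _ _ _ leb _ measurableT p^-1 _
  (@integrable_normal_pdf R 0 1).
apply: le_integrable => //.
  apply/measurable_EFinP/measurable_funM; last exact: measurable_gauss_fun.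
  exact: (@normr_measurable R setT).
move=> x _ ; rewrite normal_pdfE ?oner_neq0// -EFinM mulrA mulVf ?gt_eqF// mul1r.
rewrite !abse_EFin lee_fin ger0_norm ?mulr_ge0 ?gauss_fun_ge0//.
rewrite ger0_norm ?normal_fun_ge0// /normal_fun /gauss_fun subr0.
have -> : expR (- x ^+ 2 / (1 ^+ 2 *+ 2)) = expR (x ^+ 2 / 2) * expR (- x ^+ 2).
  by rewrite -expRD; congr expR; field.
rewrite ler_wpM2r ?expR_ge0//; apply: le_trans (expR_ge1Dx _).
rewrite -(real_normK (num_real x)).
by set y := `|x|; nra.
Qed.

End line.

(** * The Fourier transform of the Gaussian in one dimension *)

Section gauss_fourier.
Context {R : realType}.
Local Notation leb := (@lebesgue_measure R).

Lemma integrable_gauss_cos (t : R) :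
  leb.-integrable setT (fun x => (gauss_fun x * cos (t * x))%:E).
Proof.
apply: integrable_mul_bounded => [||x]; first exact: integrableT_gauss.
  apply: continuous_measurable_fun => x.
  apply: continuous_comp; last exact: continuous_cos.
  exact: mulrl_continuous.
exact: cos_max.
Qed.

Lemma integrable_gauss_sin (t : R) :
  leb.-integrable setT (fun x => (gauss_fun x * sin (t * x))%:E).
Proof.
apply: integrable_mul_bounded => [||x]; first exact: integrableT_gauss.
  apply: continuous_measurable_fun => x.
  apply: continuous_comp; last exact: continuous_sin.
  exact: mulrl_continuous.
exact: sin_max.
Qed.

(** The integrand is odd. *)
Lemma Rintegral_gauss_sin (t : R) : \int[leb]_x (gauss_fun x * sin (t * x)) = 0.
Proof.
have := Rintegral_reflection 0 (integrable_gauss_sin t).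
under eq_Rintegral do rewrite sub0r /gauss_fun sqrrN mulrN sinN mulrN.
have -> : \int[leb]_x (- (expR (- x ^+ 2) * sin (t * x))) =
   - \int[leb]_x (gauss_fun x * sin (t * x)).
  rewrite -mulN1r -RintegralZl//; last exact: integrable_gauss_sin.
  by apply: eq_Rintegral => x _; rewrite mulN1r.
lra.
Qed.

Lemma is_derive_gauss_cos (t x : R) :
  is_derive t (1 : R) (fun t => gauss_fun x * cos (t * x))
    (- (x * gauss_fun x * sin (t * x))).
Proof.
apply: is_derive_eq.
by rewrite /GRing.scale/=; ring.
Qed.

Lemma is_derive_gauss_sin (t x : R) :
  is_derive x (1 : R) (fun x => gauss_fun x * sin (t * x))
    (t * (gauss_fun x * cos (t * x)) - 2 * (x * gauss_fun x * sin (t * x))).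
Proof.
rewrite /gauss_fun.
apply: is_derive_eq.
by rewrite /GRing.scale/=; ring.
Qed.

Lemma integrable_id_gauss_sin (t : R) :
  leb.-integrable setT (fun x => (x * gauss_fun x * sin (t * x))%:E).
Proof.
apply: (le_integrable _ _ _ integrable_mul_gauss) => //.
  apply/measurable_EFinP/measurable_funM.
    by apply: measurable_funM => //; exact: measurable_gauss_fun.
  apply: continuous_measurable_fun => x.
  apply: continuous_comp; last exact: continuous_sin.
  exact: mulrl_continuous.
move=> x _; rewrite !abse_EFin lee_fin !normrM normr_id.
by rewrite ler_piMr ?sin_max// mulr_ge0.
Qed.

(** Integration by parts: the derivative of gauss_fun x * sin (t * x) has
    integral zero. *)
Lemma Rintegral_id_gauss_sin (t : R) :
  \int[leb]_x (x * gauss_fun x * sin (t * x)) =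
  t / 2 * \int[leb]_x (gauss_fun x * cos (t * x)).
Proof.
pose f x := t * (gauss_fun x * cos (t * x)) - 2 * (x * gauss_fun x * sin (t * x)).
have i1 := integrableZl measurableT t (integrable_gauss_cos t).
have i2 := integrableZl measurableT 2 (integrable_id_gauss_sin t).
have f0 : \int[leb]_x f x = 0.
  (* Both boundary terms at once: e n is n or - n. *)
  have cvg_gs (e : nat -> R) : (forall n, e n ^+ 2 = n%:R ^+ 2) ->
      gauss_fun (e n) * sin (t * e n) @[n --> \oo] --> 0.
    move=> en; apply/norm_cvg0P.
    apply: (@squeeze_cvgr _ _ _ _ (cst 0) (fun n => gauss_fun n%:R)).
    - apply: nearW => n; rewrite normr_ge0/= normrM ger0_norm ?gauss_fun_ge0//.
      by rewrite {1}/gauss_fun en ler_piMr ?gauss_fun_ge0 ?sin_max.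
    - exact: cvg_cst.
    - exact: (cvg_comp _ _ (@cvgr_idn R) cvg_gauss_fun).
  apply: (@Rintegral_derivative _ (fun x => gauss_fun x * sin (t * x))).
  - have ct : continuous (fun x : R => t * x) by exact: mulrl_continuous.
    move=> x; apply: cvgB; apply: cvgM; first exact: cvg_cst.
    + apply: cvgM; first exact: continuous_gauss_fun.
      exact: (continuous_comp (ct x) (@continuous_cos _ _)).
    + exact: cvg_cst.
    + apply: cvgM.
        by apply: cvgM; [exact: cvg_id|exact: continuous_gauss_fun].
      exact: (continuous_comp (ct x) (@continuous_sin _ _)).
  - by move=> x; exact: is_derive_gauss_sin.
  - rewrite (_ : EFin \o f = (fun x => t%:E * (gauss_fun x * cos (t * x))%:E) \-
      (fun x => 2%:E * (x * gauss_fun x * sin (t * x))%:E))%E.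
      exact: integrableB.
    by apply/funext => x /=; rewrite -!EFinM -EFinB.
  - exact: cvg_gs.
  - by apply: cvg_gs => n; rewrite sqrrN.
move: f0; rewrite /f RintegralB//.
rewrite !RintegralZl//; [|exact: integrable_id_gauss_sin|exact: integrable_gauss_cos].
lra.
Qed.

(** Differentiating under the integral produces - x * sin (t * x), and
    integrating by parts turns this back into the integral itself. *)
Lemma is_derive_gauss_fourier (t : R) :
  is_derive t (1 : R) (fun t => \int[leb]_x (gauss_fun x * cos (t * x)))
    (- (t / 2) * \int[leb]_x (gauss_fun x * cos (t * x))).
Proof.
pose f t x : R := gauss_fun x * cos (t * x).
have It : `](t - 1), (t + 1)[%classic t by rewrite /= in_itv/=; lra.
have d1E s y : derive1 (f ^~ y) s = - (y * gauss_fun y * sin (s * y)).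
  by rewrite derive1E; have := is_derive_gauss_cos s y => -?; exact: derive_val.
have intf s : `](t - 1), (t + 1)[%classic s ->
    leb.-integrable setT (EFin \o f s).
  by move=> _; exact: integrable_gauss_cos.
have derf s y : `](t - 1), (t + 1)[%classic s -> setT y ->
    derivable (f ^~ y) s 1.
  by move=> _ _; have := is_derive_gauss_cos s y.
have G0 (y : R) : 0 <= `|y| * gauss_fun y by rewrite mulr_ge0 ?gauss_fun_ge0.
have Gub s y : `](t - 1), (t + 1)[%classic s -> setT y ->
    `|derive1 (f ^~ y) s| <= `|y| * gauss_fun y.
  move=> _ _; rewrite d1E normrN !normrM (ger0_norm (gauss_fun_ge0 y)).
  by rewrite ler_piMr ?sin_max.
have D := @derivable_under_integral _ _ _ leb f setT measurableT _ _ _ It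
  intf derf _ G0 integrable_mul_gauss Gub.
have E := @differentiation_under_integral _ _ _ leb f setT measurableT _ _ _ It
  intf derf _ G0 integrable_mul_gauss Gub.
apply: DeriveDef => //; rewrite -derive1E E.
rewrite (eq_Rintegral leb
  (g := fun y => -1 * (y * gauss_fun y * sin (t * y)))); last first.
  by move=> y _; rewrite mulN1r; exact: d1E.
rewrite RintegralZl//; last exact: integrable_id_gauss_sin.
by rewrite Rintegral_id_gauss_sin mulN1r mulNr.
Qed.

(** The left-hand side F solves F' = - (t / 2) F by [is_derive_gauss_fourier],
    so F * exp (t^2 / 4) is constant. *)
Lemma Rintegral_gauss_cos (t : R) :
  \int[leb]_x (gauss_fun x * cos (t * x)) =
  \int[leb]_x gauss_fun x * expR (- (t ^+ 2 / 4)).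
Proof.
pose F t := \int[leb]_x (gauss_fun x * cos (t * x)).
have cstF : F t * expR (t ^+ 2 / 4) = F 0 * expR (0 ^+ 2 / 4).
  apply: (@is_derive_0_is_cst _ (fun t => F t * expR (t ^+ 2 / 4))) => s.
  have := is_derive_gauss_fourier s => ?.
  apply: is_derive_eq.
  by rewrite /GRing.scale/= -/(F s); field.
have F0 : F 0 = \int[leb]_x gauss_fun x.
  by apply: eq_Rintegral => x _; rewrite mul0r cos0 mulr1.
move: cstF; rewrite F0 expr0n mul0r expR0 mulr1 => <-.
by rewrite -mulrA -expRD subrr expR0 mulr1.
Qed.

End gauss_fourier.

(** * Complex integrals of products of separated variables *)

Section complex_integral_tensor.
Context {R : realType}.

Definition cintegrable d (T : measurableType d)
    (m : {measure set T -> \bar R}) (f : T -> R[i]) :=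
  m.-integrable setT (fun x => (complex.Re (f x))%:E) /\
  m.-integrable setT (fun x => (complex.Im (f x))%:E).

Definition cintegral d (T : measurableType d)
    (m : {measure set T -> \bar R}) (f : T -> R[i]) : R[i] :=
  Complex (\int[m]_x complex.Re (f x)) (\int[m]_x complex.Im (f x)).

Lemma ReM (z w : R[i]) : complex.Re (z * w) =
  complex.Re z * complex.Re w - complex.Im z * complex.Im w.
Proof. by case: z w => [a b] [c e]. Qed.

Lemma ImM (z w : R[i]) : complex.Im (z * w) =
  complex.Re z * complex.Im w + complex.Im z * complex.Re w.
Proof. by case: z w => [a b] [c e]. Qed.

Context d1 d2 (T1 : measurableType d1) (T2 : measurableType d2).
Variables (m1 : {sigma_finite_measure set T1 -> \bar R})
  (m2 : {sigma_finite_measure set T2 -> \bar R}).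

Lemma integrable_tensor (a : T1 -> R) (b : T2 -> R) :
  m1.-integrable setT (EFin \o a) -> m2.-integrable setT (EFin \o b) ->
  (m1 \x m2)%E.-integrable setT (fun z => (a z.1 * b z.2)%:E).
Proof.
move=> ia ib.
have [/measurable_EFinP ma aoo] := integrableP _ _ _ ia.
have [/measurable_EFinP mb boo] := integrableP _ _ _ ib.
have mab : measurable_fun setT (fun z : T1 * T2 => (a z.1 * b z.2)%:E).
  apply/measurable_EFinP/measurable_funM.
    exact: (measurableT_comp ma).
  exact: (measurableT_comp mb).
apply/integrable12ltyP => //=.
under eq_integral => x _.
  under eq_integral => y _ do rewrite normrM EFinM.
  rewrite integralZl//; last exact: (integrable_norm ib).
  over.
rewrite /=.
have Bfin : (\int[m2]_y `|b y|%:E)%E \is a fin_num.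
  exact: (integrable_fin_num measurableT (integrable_norm ib)).
rewrite -(fineK Bfin) integralZr//; last exact: (integrable_norm ia).
have Afin : (\int[m1]_y `|a y|%:E)%E \is a fin_num.
  exact: (integrable_fin_num measurableT (integrable_norm ia)).
by rewrite -(fineK Afin) -EFinM ltry.
Qed.

Lemma Rintegral_tensor (a : T1 -> R) (b : T2 -> R) :
  m1.-integrable setT (EFin \o a) -> m2.-integrable setT (EFin \o b) ->
  \int[(m1 \x m2)%E]_z (a z.1 * b z.2) = \int[m1]_x a x * \int[m2]_y b y.
Proof.
move=> ia ib; rewrite /Rintegral.
rewrite -(integral12_prod_meas1 (integrable_tensor ia ib))/=.
rewrite /fubini_F/=.
under eq_integral => x _.
  under eq_integral => y _ do rewrite EFinM.
  rewrite integralZl//.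
  over.
have Bfin : (\int[m2]_y (b y)%:E)%E \is a fin_num.
  exact: (integrable_fin_num measurableT ib).
have Afin : (\int[m1]_y (a y)%:E)%E \is a fin_num.
  exact: (integrable_fin_num measurableT ia).
by rewrite -(fineK Bfin) integralZr// fineM.
Qed.

Lemma cintegrable_tensor (f : T1 -> R[i]) (g : T2 -> R[i]) :
  cintegrable m1 f -> cintegrable m2 g ->
  cintegrable (m1 \x m2)%E (fun z => f z.1 * g z.2).
Proof.
move=> [f1 f2] [g1 g2]; split.
  under eq_fun do rewrite ReM EFinB.
  exact: (integrableB measurableT (integrable_tensor f1 g1)
    (integrable_tensor f2 g2)).
under eq_fun do rewrite ImM EFinD.
exact: (integrableD measurableT (integrable_tensor f1 g2)
  (integrable_tensor f2 g1)).
Qed.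

Lemma cintegral_tensor (f : T1 -> R[i]) (g : T2 -> R[i]) :
  cintegrable m1 f -> cintegrable m2 g ->
  cintegral (m1 \x m2)%E (fun z => f z.1 * g z.2) =
  cintegral m1 f * cintegral m2 g.
Proof.
move=> [f1 f2] [g1 g2]; rewrite /cintegral.
under eq_Rintegral do rewrite ReM.
under [X in Complex _ X]eq_Rintegral do rewrite ImM.
rewrite (RintegralB measurableT (integrable_tensor f1 g1)
  (integrable_tensor f2 g2)).
rewrite (RintegralD measurableT (integrable_tensor f1 g2)
  (integrable_tensor f2 g1)).
rewrite (Rintegral_tensor f1 g1) (Rintegral_tensor f2 g2).
by rewrite (Rintegral_tensor f1 g2) (Rintegral_tensor f2 g1).
Qed.

End complex_integral_tensor.

Section complex_integral_rV.
Context {R : realType}.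
Local Notation leb := (@lebesgue_measure R).

Lemma uncons_rVK d : cancel (@uncons_rV R d) (@cons_rV R d).
Proof.
move=> x; apply/rowP => j; rewrite /cons_rV /uncons_rV mxE.
by case: unliftP => [k ->|->] /=; rewrite ?mxE.
Qed.

(** The Borel measure on R^(d+1) is an image measure of a product, which gives
    access to Fubini for functions on R^(d+1). *)
Lemma cintegral_push_cons d (m : {sigma_finite_measure set 'rV[R]_d -> \bar R})
    (f : 'rV[R]_d.+1 -> R[i]) :
  cintegrable (leb \x m)%E (f \o @cons_rV R d) ->
  cintegrable (push_cons m) f /\
  cintegral (push_cons m) f = cintegral (leb \x m)%E (f \o @cons_rV R d).
Proof.
have real_case (h : 'rV[R]_d.+1 -> R) :
    (leb \x m)%E.-integrable setT (EFin \o (h \o @cons_rV R d)) ->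
    (push_cons m).-integrable setT (EFin \o h) /\
    \int[push_cons m]_x h x = \int[(leb \x m)%E]_x h (cons_rV x).
  move=> ih; have [mh _] := integrableP _ _ _ ih.
  have mh' : measurable_fun setT (EFin \o h).
    rewrite (_ : EFin \o h =
      (EFin \o (h \o @cons_rV R d)) \o @uncons_rV R d).
      exact: (measurableT_comp mh (@measurable_uncons_rV R d)).
    by apply/funext => x /=; rewrite uncons_rVK.
  have mc := @measurable_cons_rV R d.
  split.
    exact: (@integrable_pushforward _ _ _ _ _ _ mc (leb \x m)%E setT _ mh' ih).
  by rewrite /Rintegral
    (@integral_pushforward _ _ _ _ _ _ mc (leb \x m)%E setT _ mh' ih).
move=> [f1 f2].
have [? E1] := real_case (fun x => complex.Re (f x)) f1.
have [? E2] := real_case (fun x => complex.Im (f x)) f2.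
by split; [split|rewrite /cintegral [LHS](congr2 (@Complex R) E1 E2)].
Qed.

(** Induction on the dimension, splitting off the first coordinate.  The
    integrability is part of the induction since Fubini requires it. *)
Lemma cintegral_prod d (phi : 'I_d -> measurableTypeR R -> R[i]) :
  (forall i, cintegrable leb (phi i)) ->
  cintegrable (borel_lebesgue_rV R d) (fun x => \prod_i phi i (x ord0 i)) /\
  cintegral (borel_lebesgue_rV R d) (fun x => \prod_i phi i (x ord0 i)) =
  \prod_i cintegral leb (phi i).
Proof.
elim: d phi => [|d IH] phi iphi.
  split.
    split.
    - under eq_fun do rewrite big_ord0.
      exact: finite_measure_integrable_cst.
    - under eq_fun do rewrite big_ord0.
      exact: finite_measure_integrable_cst.
  rewrite /cintegral !big_ord0.
  under eq_Rintegral do rewrite big_ord0.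
  under [X in Complex _ X]eq_Rintegral do rewrite big_ord0.
  by rewrite /Rintegral !integral_dirac//= indicT mul1r mulr0.
pose psi i := phi (lift ord0 i).
have [ipsi Ipsi] := IH psi (fun i => iphi _).
have E (z : measurableTypeR R * 'rV[R]_d) :
    \prod_i phi i (cons_rV z ord0 i) =
    phi ord0 z.1 * \prod_i psi i (z.2 ord0 i).
  rewrite big_ord_recl /cons_rV mxE unlift_none; congr (_ * _).
  by apply: eq_bigr => i _; rewrite mxE liftK.
pose F (x : 'rV[R]_d.+1) := \prod_i phi i (x ord0 i).
have FE : F \o @cons_rV R d =
    (fun z => phi ord0 z.1 * \prod_i psi i (z.2 ord0 i)).
  by apply/funext => z; exact: E.
have iF : cintegrable (leb \x borel_lebesgue_rV R d)%E (F \o @cons_rV R d).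
  by rewrite FE; exact: (cintegrable_tensor (iphi ord0) ipsi).
have [i1 i2] := cintegral_push_cons iF.
split; first exact: i1.
rewrite [LHS]i2 FE (cintegral_tensor (iphi ord0) ipsi) [X in _ * X]Ipsi.
by rewrite big_ord_recl.
Qed.

End complex_integral_rV.

Lemma cintegralZ (R : realType) d (T : measurableType d)
    (m : {measure set T -> \bar R}) (c : R) (f : T -> R[i]) :
  cintegrable m f ->
  cintegrable m (fun x => real_complex R c * f x) /\
  cintegral m (fun x => real_complex R c * f x) =
  real_complex R c * cintegral m f.
Proof.
move=> [f1 f2].
have EZ x : real_complex R c * f x =
    Complex (c * complex.Re (f x)) (c * complex.Im (f x)).
  by case: (f x) => u v; apply/eqP; rewrite eq_complex/= !mul0r subr0 addr0 !eqxx.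
split.
  split; under eq_fun do rewrite EZ /= EFinM; exact: integrableZl.
rewrite /cintegral.
under eq_Rintegral do rewrite EZ /=.
under [X in Complex _ X]eq_Rintegral do rewrite EZ /=.
rewrite !RintegralZl//.
by apply/eqP; rewrite eq_complex/= !mul0r subr0 addr0 !eqxx.
Qed.

(** * Borel functions and the completed Lebesgue measure *)

Section completion.
Context {R : realType} {d : nat}.

Lemma borel_sub_lebesgue (A : set 'rV[R]_d) :
  measurable A -> measurable (A : set (euclidean R d)).
Proof.
move=> mA; apply: (@sub_caratheodory _ _ R (borel_lebesgue_rV R d)).
exact: sub_sigma_algebra.
Qed.

Lemma lebesgue_rVE (A : set 'rV[R]_d) :
  measurable A -> lebesgue_rV R d A = borel_lebesgue_rV R d A.
Proof. by move=> mA; exact: measurable_mu_extE. Qed.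

(** The identity, seen as a map from the Lebesgue measurable sets to the Borel
    sets.  The image under it of the completed measure is the Borel measure. *)
Definition of_euclidean (x : euclidean R d) : 'rV[R]_d := x.

Lemma measurable_of_euclidean : measurable_fun setT of_euclidean.
Proof.
by move=> _ A mA; rewrite setTI; exact: borel_sub_lebesgue.
Qed.

Lemma borel_lebesgue_measurable (h : 'rV[R]_d -> R) :
  measurable_fun setT h -> lebesgue_measurable h.
Proof. by move=> mh; exact: (measurableT_comp mh measurable_of_euclidean). Qed.

Lemma complex_integral_borel (f : 'rV[R]_d -> R[i]) :
  cintegrable (borel_lebesgue_rV R d) f ->
  complex_integral f = cintegral (borel_lebesgue_rV R d) f.
Proof.
have mid := measurable_of_euclidean.
have real_case (h : 'rV[R]_d -> R) :
    (borel_lebesgue_rV R d).-integrable setT (EFin \o h) ->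
    \int[lebesgue_rV R d]_x h x = \int[borel_lebesgue_rV R d]_x h x.
  move=> ih; have [mh hoo] := integrableP _ _ _ ih.
  have ih' : (lebesgue_rV R d).-integrable setT
      ((EFin \o h) \o of_euclidean).
    apply/integrableP; split; first exact: (measurableT_comp mh mid).
    move: hoo; apply: le_lt_trans.
    rewrite -[leLHS](@ge0_integral_pushforward _ _ _ _ _ _ mid
      (lebesgue_rV R d) setT (fun x => `|(h x)%:E|%E))//; last first.
      by apply: measurableT_comp => //.
    rewrite le_eqVlt; apply/orP; left; apply/eqP.
    by apply: eq_measure_integral => A mA _; exact: lebesgue_rVE.
  rewrite /Rintegral; congr fine.
  rewrite -[LHS](@integral_pushforward _ _ _ _ _ _ mid
    (lebesgue_rV R d) setT _ mh ih')//.
  by apply: eq_measure_integral => A mA _; exact: lebesgue_rVE.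
move=> [i1 i2].
by congr Complex; [exact: (real_case (fun x => complex.Re (f x)))|
  exact: (real_case (fun x => complex.Im (f x)))].
Qed.

End completion.

(** * The Fourier transform of translated Gaussians *)

Section gauss_fourier_rV.
Context {R : realType}.
Local Notation leb := (@lebesgue_measure R).

(** The Fourier kernel exp (- i t). *)
Definition cis (t : R) : R[i] := Complex (cos t) (- sin t).

Lemma cis0 : cis 0 = 1.
Proof. by rewrite /cis cos0 sin0 oppr0. Qed.

Lemma cisD s t : cis (s + t) = cis s * cis t.
Proof.
rewrite /cis cosD sinD; apply/eqP; rewrite eq_complex /=.
by apply/andP; split; apply/eqP; ring.
Qed.

Lemma cis_sum (I : Type) (s : seq I) (t : I -> R) :
  cis (\sum_(i <- s) t i) = \prod_(i <- s) cis (t i).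
Proof. by apply: (big_morph cis cisD cis0). Qed.

Definition gauss_mass : R := \int[leb]_x gauss_fun x.

Lemma cintegrable_gauss1 (a t : R) :
  cintegrable leb (fun x => real_complex R (gauss_fun (x - a)) * cis (t * x)).
Proof.
have ig : leb.-integrable setT (EFin \o (fun x => gauss_fun (x - a))).
  apply: eq_integrable (integrable_reflection a integrableT_gauss) => //.
  by move=> x _; rewrite /gauss_fun /= -sqrrN opprB.
have ct : continuous (fun x : R => t * x) by exact: mulrl_continuous.
split.
- under eq_fun do rewrite ReM /= mul0r subr0.
  apply: integrable_mul_bounded => //; last by move=> x; exact: cos_max.
  apply: continuous_measurable_fun => x.
  exact: (continuous_comp (ct x) (@continuous_cos _ _)).
- under eq_fun do rewrite ImM /= mul0r addr0.
  apply: (integrable_mul_bounded (h := fun x => - sin (t * x))) => //.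
    apply: continuous_measurable_fun => x; apply: cvgN.
    exact: (continuous_comp (ct x) (@continuous_sin _ _)).
  by move=> x; rewrite normrN sin_max.
Qed.

(** The reflection x |-> a - x replaces the translated Gaussian by the centred
    one; the addition formulas then extract the phase, and the sine integral
    vanishes. *)
Lemma cintegral_gauss1 (a t : R) :
  cintegral leb (fun x => real_complex R (gauss_fun (x - a)) * cis (t * x)) =
  real_complex R (gauss_mass * expR (- (t ^+ 2 / 4))) * cis (t * a).
Proof.
have [i1 i2] := cintegrable_gauss1 a t.
have ic := integrable_gauss_cos t; have isn := integrable_gauss_sin t.
have icZ k : leb.-integrable setT
    (EFin \o (fun x => k * (gauss_fun x * cos (t * x)))).
  exact: (integrableZl measurableT k ic).
have isZ k : leb.-integrable setT
    (EFin \o (fun x => k * (gauss_fun x * sin (t * x)))).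
  exact: (integrableZl measurableT k isn).
have mass_cos : gauss_mass * expR (- (t ^+ 2 / 4)) =
    \int[leb]_x (gauss_fun x * cos (t * x)) by rewrite Rintegral_gauss_cos.
have g_even x : gauss_fun (a - x - a) = gauss_fun x :> R.
  by rewrite /gauss_fun addrAC subrr sub0r sqrrN.
apply/eqP; rewrite eq_complex; apply/andP; split; apply/eqP.
- rewrite [LHS](esym (Rintegral_reflection a i1)) [RHS]ReM [RHS]/= mul0r subr0 mass_cos.
  under eq_Rintegral => x _.
    rewrite ReM /= mul0r subr0 g_even mulrBr cosB.
    rewrite (_ : _ * _ = cos (t * a) * (gauss_fun x * cos (t * x)) +
      sin (t * a) * (gauss_fun x * sin (t * x))); last by ring.
    over.
  rewrite (RintegralD measurableT (icZ _) (isZ _)).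
  rewrite !RintegralZl// Rintegral_gauss_sin; ring.
- rewrite [LHS](esym (Rintegral_reflection a i2)) [RHS]ImM [RHS]/= mul0r addr0 mass_cos.
  under eq_Rintegral => x _.
    rewrite ImM /= mul0r addr0 g_even mulrBr sinB.
    rewrite (_ : _ * _ = cos (t * a) * (gauss_fun x * sin (t * x)) -
      sin (t * a) * (gauss_fun x * cos (t * x))); last by ring.
    over.
  rewrite (RintegralB measurableT (isZ _) (icZ _)).
  rewrite !RintegralZl// Rintegral_gauss_sin; ring.
Qed.

Definition gauss_rV d (a x : 'rV[R]_d) : R :=
  \prod_i gauss_fun (x ord0 i - a ord0 i).

(** Both the Gaussian and the Fourier kernel are products over the coordinates,
    so the integral is a product of one-dimensional ones.  A translation of the
    Gaussian only changes the phase. *)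
Lemma fourier_gauss_rV d (c : R) (a xi : 'rV[R]_d) :
  fourier (fun x => real_complex R (c * gauss_rV a x)) xi =
  real_complex R (c * gauss_mass ^+ d * gauss_rV 0 (pi *: xi)) *
  cis (2 * pi * dotv a xi).
Proof.
pose phi i (x : measurableTypeR R) :=
  real_complex R (gauss_fun (x - a ord0 i)) * cis (2 * pi * xi ord0 i * x).
have iphi i : cintegrable leb (phi i) by exact: cintegrable_gauss1.
have [ip Ip] := cintegral_prod iphi.
have E (x : 'rV[R]_d) : real_complex R (c * gauss_rV a x) *
    cis (2 * pi * dotv x xi) = real_complex R c * \prod_i phi i (x ord0 i).
  rewrite rmorphM /= -[LHS]mulrA; congr (_ * _).
  rewrite /gauss_rV rmorph_prod /dotv mulr_sumr cis_sum -big_split/=.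
  by apply: eq_bigr => i _; rewrite /phi; congr (_ * cis _); ring.
have [iZ cZ] := cintegralZ c ip.
transitivity (complex_integral
    (fun x : 'rV[R]_d => real_complex R c * \prod_i phi i (x ord0 i))).
  by congr complex_integral; apply/funext => x; exact: E.
rewrite complex_integral_borel// cZ Ip.
rewrite (eq_bigr (fun i => real_complex R (gauss_mass) *
  (real_complex R (gauss_fun (pi * xi ord0 i)) *
   cis (2 * pi * (a ord0 i * xi ord0 i))))); last first.
  move=> i _; rewrite cintegral_gauss1 rmorphM -[LHS]mulrA; congr (_ * (_ * cis _)).
    by congr (real_complex R (expR _)); field.
  ring.
rewrite !big_split/= prodr_const card_ord -cis_sum -mulr_sumr -rmorph_prod.
rewrite -rmorphXn/= mulrA mulrA -!rmorphM/=; congr (real_complex R _ * _).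
rewrite -[RHS]mulrA; congr (_ * (_ * _)).
by apply: eq_bigr => i _; rewrite !mxE subr0.
Qed.

End gauss_fourier_rV.

(** * Boxes and unit cubes *)

Section boxes.
Context {R : realType}.

Definition box d (b : 'I_d -> R) (s : R) : set 'rV[R]_d :=
  [set x | forall i, b i <= x ord0 i < b i + s].

Lemma measurable_box d (b : 'I_d -> R) s : measurable (box b s).
Proof.
rewrite (_ : box b s = \bigcap_(i in [set: 'I_d])
    ((fun x : 'rV[R]_d => x ord0 i) @^-1` `[b i, b i + s[)).
  apply: fin_bigcap_measurable => // i _.
  by rewrite -[X in measurable X]setTI; exact: measurable_coord_rV.
apply/seteqP; split => x /= bx i; first by move=> _ /=; rewrite in_itv/= bx.
by have := bx i Logic.I; rewrite /preimage /= in_itv.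
Qed.

Lemma borel_lebesgue_box d (b : 'I_d -> R) s : 0 <= s ->
  borel_lebesgue_rV R d (box b s) = (s ^+ d)%:E.
Proof.
move=> s0; elim: d b => [|d IH] b.
  by rewrite /= diracE mem_set// => -[].
rewrite /= /push_cons /pushforward.
rewrite (_ : _ @^-1` _ = `[b ord0, b ord0 + s[ `*` box (b \o lift ord0) s).
  rewrite product_measure1E//; last exact: measurable_box.
  have L : lebesgue_measure `[b ord0, b ord0 + s[%classic = s%:E.
    rewrite lebesgue_measure_itv/= lte_fin ltrDl -EFinB addrAC subrr add0r.
    by move: s0; rewrite le_eqVlt => /predU1P[<-|->//]; rewrite ltxx.
  by rewrite [X in (_ * X)%E]IH [X in (X * _)%E]L exprS EFinM.
apply/seteqP; split => [z /= bz|z [/= z1 z2] i].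
  split => [|i] /=.
    by have := bz ord0; rewrite /cons_rV mxE unlift_none in_itv.
  by have := bz (lift ord0 i); rewrite /cons_rV mxE liftK.
rewrite /cons_rV mxE; case: unliftP => [j ->|->]; first exact: z2.
by move: z1; rewrite in_itv.
Qed.

Lemma cubeE d (a : 'rV[int]_d) :
  cube a = box (fun i => (a ord0 i)%:~R) 1 :> set 'rV[R]_d.
Proof. by []. Qed.

Lemma lebesgue_cube d (a : 'rV[int]_d) : lebesgue_rV R d (cube a) = 1%E.
Proof.
rewrite cubeE lebesgue_rVE; last exact: measurable_box.
by rewrite borel_lebesgue_box// expr1n.
Qed.

Lemma measurable_cube d (a : 'rV[int]_d) :
  measurable (cube a : set (euclidean R d)).
Proof. by apply: borel_sub_lebesgue; rewrite cubeE; exact: measurable_box. Qed.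

Lemma rV_norm_leP d (x : 'rV[R]_d) (M : R) : 0 <= M ->
  (`|x| <= M) <-> (forall i, `|x ord0 i| <= M).
Proof.
move=> M0; rewrite /Num.norm/= mx_normrE; split=> [/bigmax_leP[_ xM] i|xM].
  exact: (xM (ord0, i)).
by apply: bigmax_le => // -[j i] _ /=; rewrite (ord1 j); exact: xM.
Qed.

Lemma coord_norm_le d (x : 'rV[R]_d) i : `|x ord0 i| <= `|x|.
Proof. by move: i; apply/rV_norm_leP. Qed.

End boxes.

(** * Invariance of the Lebesgue outer measure under reflections *)

Section reflection_rV.
Context {R : realType}.
Local Notation leb := (@lebesgue_measure R).

Let refl d (c x : 'rV[R]_d) : 'rV[R]_d := c - x.

Lemma measurable_reflection_rV d (c : 'rV[R]_d) :
  measurable_fun setT (refl c).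
Proof.
apply: measurable_fun_rV => i; rewrite /refl.
under eq_fun do rewrite !mxE.
by apply: measurable_funB => //; exact: measurable_coord_rV.
Qed.

(** Induction on the dimension.  In the step both sides are product measures,
    and these are determined by their values on rectangles. *)
Lemma borel_lebesgue_reflection d (c : 'rV[R]_d) A : measurable A ->
  borel_lebesgue_rV R d (refl c @^-1` A) = borel_lebesgue_rV R d A.
Proof.
elim: d c A => [|d IH] c A mA.
  congr (borel_lebesgue_rV R 0 _); apply/seteqP.
  by split=> x /=; rewrite [refl _ _]thinmx0 [x]thinmx0.
rewrite /= /push_cons /pushforward.
pose T (z : measurableTypeR R * 'rV[R]_d) : measurableTypeR R * 'rV[R]_d :=
  (c ord0 ord0 - z.1, (uncons_rV c).2 - z.2).
have mT : measurable_fun setT T.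
  apply: measurable_fun_pair => /=.
    by apply: measurable_funB => //; exact: measurable_fst.
  exact: (measurableT_comp (measurable_reflection_rV _) measurable_snd).
have TE z : refl c (cons_rV z) = cons_rV (T z).
  apply/rowP => i; rewrite /refl /cons_rV !mxE.
  by case: unliftP => [j ->|->] //=; rewrite !mxE.
have mA' : measurable (@cons_rV R d @^-1` A).
  by rewrite -[X in measurable X]setTI; exact: measurable_cons_rV.
rewrite (_ : _ @^-1` _ = T @^-1` (@cons_rV R d @^-1` A)); last first.
  by apply/seteqP; split=> z /=; rewrite TE.
apply/esym.
rewrite [LHS](@product_measure_unique _ _ _ _ _ leb (borel_lebesgue_rV R d)
  (pushforward (leb \x borel_lebesgue_rV R d)%E T))//.
have mr : measurable_fun setT
    ((fun x => c ord0 ord0 - x) : measurableTypeR R -> measurableTypeR R).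
  exact: measurable_funB.
move=> X Y mX mY; rewrite /= /pushforward.
rewrite (_ : T @^-1` _ = (fun x : R => c ord0 ord0 - x) @^-1` X `*`
   (refl (uncons_rV c).2 @^-1` Y))//.
rewrite product_measure1E; last 2 first.
- rewrite -[X in measurable X]setTI.
  exact: mr.
- by rewrite -[X in measurable X]setTI; exact: measurable_reflection_rV.
by rewrite [X in (_ * X)%E]IH// [X in (X * _)%E](lebesgue_measure_reflection _ mX).
Qed.

(** A cover of A by Borel sets is reflected to a cover of the reflected set with
    the same total measure.  Working with the outer measure avoids proving that
    reflections preserve Lebesgue measurable sets. *)
Lemma lebesgue_outer_reflection d (c : 'rV[R]_d) (A : set 'rV[R]_d) :
  (lebesgue_rV R d (refl c @^-1` A) <= lebesgue_rV R d A)%E.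
Proof.
apply: le_ereal_inf_tmp => _ [F [mF AF] <-].
apply: ereal_inf_lbound; exists (fun n => refl c @^-1` F n).
  split=> [n|x Ax].
    by rewrite -[X in measurable X]setTI; exact: measurable_reflection_rV.
  by have [n _ Fn] := AF _ Ax; exists n.
by apply: eq_eseriesr => n _; exact: borel_lebesgue_reflection.
Qed.

End reflection_rV.

(** * Growth of Beurling weights *)

Section weights.
Context {R : realType} {d : nat}.
Variable w : 'rV[R]_d -> R.
Hypothesis ww : beurling_weight w.

Let w_ge1 x : 1 <= w x. Proof. by have [_ _ + _] := ww; exact. Qed.
Let w_gt0 x : 0 < w x. Proof. exact: lt_le_trans (w_ge1 x). Qed.
Let w_ge0 x : 0 <= w x. Proof. exact: ltW. Qed.
Let wM x y : w (x + y) <= w x * w y.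
Proof. by have [_ _ _ +] := ww; exact. Qed.

(** The superlevel sets decrease to the empty set as N grows. *)
Lemma superlevel_small (Q : set (euclidean R d)) : measurable Q ->
  (lebesgue_rV R d Q < +oo)%E ->
  exists N : nat, (lebesgue_rV R d (Q `&` [set x | (N%:R < w x)%R]) < (1/2)%:E)%E.
Proof.
move=> mQ Qoo.
pose D n : set (euclidean R d) := Q `&` [set x | n%:R < w x].
have [mw _ _ _] := ww.
have mD n : measurable (D n).
  rewrite /D (_ : [set x | _] = (w : euclidean R d -> R) @^-1` `]n%:R, +oo[).
    by apply: measurableI => //; rewrite -[X in measurable X]setTI; exact: mw.
  by apply/seteqP; split => x /=; rewrite in_itv/= andbT.
have D0 : \bigcap_n D n = set0.
  apply/seteqP; split=> // x Dx.
  have [_ /=] := Dx (Num.truncn (w x)).+1 Logic.I.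
  by rewrite ltNge ltW// truncnS_gt.
have cD : lebesgue_rV R d (D n) @[n --> \oo] --> lebesgue_rV R d (\bigcap_n D n).
  apply: nonincreasing_cvg_mu => //.
  - by rewrite (le_lt_trans _ Qoo)// le_measure ?inE//; exact: subIsetl.
  - exact: bigcap_measurable.
  - move=> m n mn; apply/subsetPset => x [Qx /= nw]; split=> //=.
    by rewrite (le_lt_trans _ nw)// ler_nat.
rewrite D0 measure0 in cD.
have : \forall n \near \oo, (lebesgue_rV R d (D n) < (1/2)%:E)%E.
  apply: (cD [set y | (y < (1 / 2)%:E)%E]).
  by apply: open_ereal_lt'; rewrite lte_fin; lra.
by move=> [N _ /(_ N (leqnn N))]; exists N.
Qed.

(** Steinhaus' argument.  Let Q be a fixed box and let D be the part of Q where
    w exceeds N, with N so large that D has measure less than 1/2.  If |x| <= 1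
    and w x > N^2, then for every y one of w y and w (x - y) exceeds N, because
    w x <= w y * w (x - y).  Hence the points y for which both y and x - y
    belong to Q are covered by D and its reflection x - D, of total measure less
    than 1; but these points contain a unit cube. *)
Lemma weight_unit_bounded : exists2 B : R, 1 <= B & forall x, `|x| <= 1 -> w x <= B.
Proof.
(* With |x| <= 1 and y in the cube C below, x - y has coordinates in [-1, 1];
   the box is half-open, so side 3 is taken to contain the endpoint 1. *)
pose Q : set 'rV[R]_d := box (fun=> -1) 3.
have Qfin : (lebesgue_rV R d Q < +oo)%E.
  rewrite lebesgue_rVE; last exact: measurable_box.
  by rewrite borel_lebesgue_box// ltry.
have [N DN] := superlevel_small (borel_sub_lebesgue (measurable_box _ _)) Qfin.
set D := _ `&` _ in DN.
exists (1 + N%:R ^+ 2); first by rewrite lerDl sqr_ge0.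
move=> x x1; rewrite leNgt; apply/negP => wx.
(* The unit cube whose coordinates have the signs of those of x. *)
pose C : set 'rV[R]_d := box (fun i => if 0 <= x ord0 i then 0 else -1) 1.
have xi i : `|x ord0 i| <= 1 by exact: le_trans (coord_norm_le _ _) x1.
have CD : C `<=` D `|` (fun y => x - y) @^-1` D.
  move=> y Cy.
  have Qy : Q y.
    by move=> i; move: (Cy i); case: ifP => _; lra.
  have Qxy : Q (x - y).
    move=> i; rewrite !mxE; move: (Cy i) (xi i); rewrite ler_norml.
    by case: ifP => [|/negbT]; rewrite -?ltNge => ? ? /andP[]; lra.
  have [wy|wy] := ltP N%:R (w y); first by left.
  right; split => //=; rewrite ltNge; apply/negP => wxy.
  have : w x <= N%:R ^+ 2.
    rewrite -[x in w x](subrKC y) expr2 (le_trans (wM _ _))//.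
    exact: ler_pM.
  by rewrite leNgt (lt_trans _ wx)// ltrDr.
have C1 : lebesgue_rV R d C = 1%E.
  rewrite lebesgue_rVE; last exact: measurable_box.
  by rewrite borel_lebesgue_box// expr1n.
have : (lebesgue_rV R d C <= lebesgue_rV R d D + lebesgue_rV R d D)%E.
  apply: le_trans (le_mu_ext _ CD) _.
  apply: le_trans (outer_measureU2 _ _ _) _.
  by rewrite leeD2l//; exact: lebesgue_outer_reflection.
rewrite C1; apply/negP; rewrite -ltNge.
apply: lt_le_trans (lteD DN DN) _.
by rewrite -EFinD lee_fin; lra.
Qed.

Lemma weight_mulrn x n : w (x *+ n.+1) <= w x ^+ n.+1.
Proof.
elim: n => [|n IH]; first by rewrite expr1.
rewrite mulrS exprS (le_trans (wM _ _))// ler_wpM2l//.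
Qed.

(** A vector x is the sum of n + 1 vectors of the unit ball, with n the integral
    part of its norm, whence w x <= B^(n+1).  The bound is written as a product
    over the coordinates in order to be compared with the Gaussian. *)
Lemma weight_exp_bound : exists C k : R, [/\ 1 <= C, 0 <= k &
  forall x, w x <= C * \prod_i expR (k * `|x ord0 i|)].
Proof.
have [B B1 wB] := weight_unit_bounded.
have B0 : 0 < B by lra.
exists B, (ln B); split => //; first exact: ln_ge0.
move=> x; pose n := Num.truncn `|x|.
have nx : `|x| < n.+1%:R by exact: truncnS_gt.
have xE : x = (n.+1%:R^-1 *: x) *+ n.+1.
  by rewrite -scaler_nat scalerA divff ?scale1r// pnatr_eq0.
rewrite {1}xE (le_trans (weight_mulrn _ _))//.
have : w (n.+1%:R^-1 *: x) <= B.
  apply: wB; rewrite mx_normZ ger0_norm ?invr_ge0//.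
  by rewrite ler_pdivrMl// mulr1 ltW.
move=> /(lerXn2r n.+1 (w_ge0 _) (ltW B0)) /le_trans; apply.
rewrite exprS; apply: ler_wpM2l; first exact: ltW.
rewrite -expR_sum -{1}(lnK B0) -expRM_natl ler_expR.
rewrite -mulr_sumr mulrC ler_wpM2l ?ln_ge0//.
apply: (@le_trans _ _ `|x|); first by rewrite truncn_le.
apply/rV_norm_leP; first exact: sumr_ge0.
by move=> i; rewrite (bigD1 i)//= lerDl sumr_ge0.
Qed.

End weights.

(** * Sums over the integer lattice *)

Section lattice_sums.
Context {R : realType}.
Local Open Scope ereal_scope.

Lemma esumZl_le (T : choiceType) (S : set T) (k : R) (a : T -> \bar R) :
  (0 <= k)%R -> (forall i, 0 <= a i) ->
  \esum_(i in S) (k%:E * a i) <= k%:E * \esum_(i in S) a i.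
Proof.
move=> k0 a0; apply: ge_ereal_sup => _ [X [finX XS] <-].
rewrite -ge0_mule_fsumr//; apply: lee_wpmul2l; first by rewrite lee_fin.
by apply: ereal_sup_ubound; exists X.
Qed.

Lemma esum_pair (T1 T2 : choiceType) (a : T1 * T2 -> \bar R) :
  (forall z, 0 <= a z) ->
  \esum_(z in [set: T1 * T2]) a z =
  \esum_(i in [set: T1]) \esum_(j in [set: T2]) a (i, j).
Proof.
move=> a0; rewrite (esum_esum (a := fun i j => a (i, j)))//.
rewrite (_ : _ `*`` _ = setT); last by apply/seteqP; split.
by apply: eq_esum => -[].
Qed.

(** The terms of a summable product sequence on the lattice, used to dominate
    Gaussians times weights; any geometric ratio would do. *)
Definition decay (k : int) : R := (2^-1 ^+ `|k|%N)%R.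

Lemma decay_ge0 k : (0 <= decay k)%R.
Proof. by rewrite exprn_ge0// invr_ge0. Qed.

(** Each of the two halves Posz and Negz of the integers contributes at most a
    geometric series. *)
Lemma esum_decay_int : \esum_(k in [set: int]) (decay k)%:E < +oo.
Proof.
pose e (bn : bool * nat) := if bn.1 then Posz bn.2 else Negz bn.2.
have be : set_bij [set: bool * nat] [set: int] e.
  split=> //.
  - by move=> [[] n] [[] m] _ _ //= [->].
  - by case=> n _; [exists (true, n)|exists (false, n)].
have S : \esum_(n in [set: nat]) (2^-1 ^+ n)%:E = 2%:E :> \bar R.
  rewrite -nneseries_esumT; last by move=> n; rewrite lee_fin exprn_ge0 ?invr_ge0.
  (* Here the general term 2 / 2^(k+1) is 2^(-k). *)
  have := @cvg_geometric_eseries_half R 2 0; rewrite expr0 divr1 => /cvg_lim <-//.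
  congr (limn _); apply/funext => n; rewrite /eseries/=.
  apply: eq_bigr => k _; congr EFin.
  by rewrite addn1 expnS natrM invfM mulrA divff ?pnatr_eq0// mul1r natrX exprVn.
rewrite (reindex_esum _ _ _ _ be) esum_pair; last first.
  by move=> z; rewrite lee_fin decay_ge0.
apply: (@le_lt_trans _ _ (\esum_(b in [set: bool]) 2%:E)).
  apply: le_esum => b _; rewrite -S; apply: le_esum => n _.
  rewrite lee_fin /decay; case: b => //=.
  by rewrite exprS ler_piMl ?exprn_ge0 ?invr_ge0//; lra.
rewrite (_ : [set: bool] = [set true] `|` [set false]); last first.
  by apply/seteqP; split=> // -[] _; [left|right].
rewrite esum_fset//.
rewrite fsbig_finite//=.
by apply: lte_sum_pinfty => i _; exact: ltry.
Qed.

Definition decay_rV d (a : 'rV[int]_d) : R := (\prod_i decay (a ord0 i))%R.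

Lemma decay_rV_ge0 d (a : 'rV[int]_d) : (0 <= decay_rV a)%R.
Proof. by apply: prodr_ge0 => i _; exact: decay_ge0. Qed.

(** Induction on the dimension: the sum is a product of one-dimensional sums. *)
Lemma esum_decay_rV d : \esum_(a in [set: 'rV[int]_d]) (decay_rV a)%:E < +oo.
Proof.
elim: d => [|d IH].
  rewrite (_ : setT = [set 0%R]).
    by rewrite esum_set1 ?lee_fin ?decay_rV_ge0// ltry.
  by apply/seteqP; split=> // x _ /=; rewrite [x]thinmx0.
pose e (z : int * 'rV[int]_d) : 'rV[int]_d.+1 :=
  (\row_i (if unlift ord0 i is Some j then z.2 ord0 j else z.1))%R.
have eE k v : decay_rV (e (k, v)) = (decay k * decay_rV v)%R.
  rewrite /decay_rV big_ord_recl /e mxE unlift_none; congr (_ * _)%R.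
  by apply: eq_bigr => i _; rewrite mxE liftK.
have be : set_bij [set: int * 'rV[int]_d] setT e.
  split=> //.
  - move=> [k u] [l v] _ _ /rowP E; congr pair.
      by have := E ord0; rewrite !mxE unlift_none.
    by apply/rowP => j; have := E (lift ord0 j); rewrite !mxE liftK.
  - move=> x _; exists (x ord0 ord0, \row_j x ord0 (lift ord0 j))%R => //.
    apply/rowP => j; rewrite mxE.
    by case: unliftP => [i ->|->] //=; rewrite mxE.
pose S := \esum_(v in [set: 'rV[int]_d]) (decay_rV v)%:E.
have S0 : 0 <= S by apply: esum_ge0 => v _; rewrite lee_fin decay_rV_ge0.
have Sfin : S \is a fin_num by rewrite ge0_fin_numE.
rewrite (reindex_esum _ _ _ _ be) esum_pair; last first.
  by move=> z; rewrite lee_fin decay_rV_ge0.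
apply: (@le_lt_trans _ _ (\esum_(k in [set: int]) ((fine S)%:E * (decay k)%:E))).
  apply: le_esum => k _.
  rewrite muleC fineK//.
  apply: le_trans (esumZl_le _ (decay_ge0 k) _); last first.
    by move=> v; rewrite lee_fin decay_rV_ge0.
  by apply: le_esum => v _; rewrite eE EFinM.
apply: le_lt_trans (esumZl_le _ _ _) _.
- by rewrite fine_ge0.
- by move=> k; rewrite lee_fin decay_ge0.
by rewrite lte_mul_pinfty ?lee_fin ?fine_ge0// esum_decay_int.
Qed.

End lattice_sums.

(** * Comparison of L^p norms *)

Section Lnorm_bounds.
Context d (T : measurableType d) (R : realType).
Variable mu : {measure set T -> \bar R}.
Local Open Scope ereal_scope.

(** The integral of a nonnegative function is a supremum over the simple
    functions below it, and a larger function has more of them.  This is applied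
    to restrictions to arbitrary compact sets. *)
Lemma ge0_le_integral_nonmeasurable (f g : T -> \bar R) :
  (forall x, 0 <= f x) -> (forall x, f x <= g x) ->
  \int[mu]_x f x <= \int[mu]_x g x.
Proof.
move=> f0 fg; have g0 x : 0 <= g x by exact: le_trans (fg x).
rewrite !ge0_integralTE//; apply: le_ereal_sup => _ [h hf <-].
by exists h => // x; exact: le_trans (fg x).
Qed.

Lemma ge0_le_poweR (s : R) (x y : \bar R) :
  (0 <= s)%R -> 0 <= x -> x <= y -> x `^ s <= y `^ s.
Proof.
move=> s0 x0 xy; apply: (gt0_ler_poweR s0) => //; rewrite in_itv/= leey andbT//.
exact: le_trans xy.
Qed.

Lemma Lnorm_mono (p : R) (f g : T -> \bar R) : (0 < p)%R ->
  (forall x, `|f x| <= `|g x|) -> 'N[mu]_p%:E[f] <= 'N[mu]_p%:E[g].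
Proof.
move=> p0 fg; rewrite unlock /Lnorm.
have mono x : `|f x| `^ p <= `|g x| `^ p.
  by apply: ge0_le_poweR => //; exact: ltW.
apply: ge0_le_poweR.
- by rewrite invr_ge0 ltW.
- by apply: integral_ge0 => x _; exact: poweR_ge0.
- by apply: ge0_le_integral_nonmeasurable => // x; exact: poweR_ge0.
Qed.

Lemma Lnorm_cst_restrict (p M : R) (D : set T) : (0 < p)%R -> (0 <= M)%R ->
  measurable D ->
  'N[mu]_p%:E[(fun=> M%:E) \_ D] = M%:E * mu D `^ p^-1.
Proof.
move=> p0 M0 mD; rewrite unlock /Lnorm.
transitivity ((\int[mu]_(x in D) (M%:E `^ p)) `^ p^-1).
  congr (_ `^ _); rewrite [RHS]integral_mkcond; apply: eq_integral => x _.
  rewrite !patchE; case: ifP => _; first by rewrite gee0_abs// lee_fin.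
  by rewrite abse0 poweR0r// gt_eqF.
have MK : (M%:E `^ p) `^ p^-1 = M%:E.
  by rewrite -poweRrM divff ?gt_eqF// poweRe1.
rewrite integral_cst// poweRM ?measure_ge0 ?lee_fin ?powR_ge0//.
exact: (congr1 (mule^~ _) MK).
Qed.

Lemma Lnorm_scale (p C : R) (f : T -> \bar R) : (0 < p)%R -> (0 <= C)%R ->
  measurable_fun setT f ->
  'N[mu]_p%:E[(fun x => C%:E * f x)] = C%:E * 'N[mu]_p%:E[f].
Proof.
move=> p0 C0 mf; rewrite unlock /Lnorm.
have CK : ((C `^ p)%:E) `^ p^-1 = C%:E.
  by rewrite poweR_EFin -powRrM divff ?gt_eqF// powRr1.
rewrite -[in RHS]CK -poweRM ?lee_fin ?powR_ge0//; last first.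
  by apply: integral_ge0 => x _; exact: poweR_ge0.
congr (_ `^ _); rewrite -ge0_integralZl//; last 3 first.
- apply: (measurableT_comp (measurable_poweR p)).
  by apply: measurableT_comp => //.
- by move=> x _; exact: poweR_ge0.
- by rewrite lee_fin powR_ge0.
apply: eq_integral => x _; rewrite abseM poweRM//.
by rewrite gee0_abs ?lee_fin.
Qed.

End Lnorm_bounds.

(** * Amalgam norms *)

Section amalgam_bounds.
Context {R : realType} {d : nat}.
Local Notation mu := (lebesgue_rV R d).
Local Notation normc := ComplexField.Normc.normc.
Implicit Types (f g : 'rV[R]_d -> R[i]) (p q : R).

Lemma normc_ge0 (z : R[i]) : 0 <= normc z.
Proof. by case: z => a b; exact: sqrtr_ge0. Qed.

Lemma normc_real (x : R) : normc (real_complex R x) = `|x|.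
Proof. by rewrite /= expr0n/= addr0 sqrtr_sqr. Qed.

Lemma modulus_weight f (w : 'rV[R]_d -> R) x : 0 <= w x ->
  normc (f x * real_complex R (w x)) = normc (f x) * w x.
Proof. by move=> w0; rewrite ComplexField.Normc.normcM normc_real ger0_norm. Qed.

Lemma measurable_modulus f : complex_measurable f ->
  measurable_fun [set: euclidean R d]
    ((fun x => normc (f x)) : euclidean R d -> R).
Proof.
move=> [mr mi].
have -> : (fun x : 'rV[R]_d => normc (f x)) =
    (fun x => Num.sqrt (complex.Re (f x) ^+ 2 + complex.Im (f x) ^+ 2)).
  by apply/funext => x; case: (f x).
apply: (measurableT_comp (continuous_measurable_fun (@sqrt_continuous R))).
by apply: measurable_funD; apply: measurable_funX.
Qed.

Lemma complex_measurableM f (w : 'rV[R]_d -> R) : complex_measurable f ->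
  lebesgue_measurable w -> complex_measurable (fun x => f x * real_complex R (w x)).
Proof.
move=> [mr mi] mw; split; rewrite /lebesgue_measurable.
  under eq_fun do rewrite ReM /= mulr0 subr0.
  exact: measurable_funM.
under eq_fun do rewrite ImM /= mulr0 add0r.
exact: measurable_funM.
Qed.

Local Open Scope ereal_scope.

Lemma Lnorm_cube_le p f a (M : R) : (0 < p)%R -> (0 <= M)%R ->
  (forall x, cube a x -> (normc (f x) <= M)%R) ->
  'N[mu]_p%:E[modulus f \_ (cube a)] <= M%:E.
Proof.
move=> p0 M0 fM; rewrite -[leRHS]mule1 -(poweR1r p^-1) -(lebesgue_cube (R:=R) a).
rewrite -Lnorm_cst_restrict//; last exact: measurable_cube.
apply: Lnorm_mono => // x; rewrite !patchE; case: ifP => // /set_mem ax.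
by rewrite !abse_EFin lee_fin !ger0_norm ?normc_ge0//; exact: fM.
Qed.

Lemma Lnorm_cube_ge p f a (M : R) : (0 < p)%R -> (0 <= M)%R ->
  (forall x, cube a x -> (M <= normc (f x))%R) ->
  M%:E <= 'N[mu]_p%:E[modulus f \_ (cube a)].
Proof.
move=> p0 M0 fM; rewrite -[leLHS]mule1 -(poweR1r p^-1) -(lebesgue_cube (R:=R) a).
rewrite -Lnorm_cst_restrict//; last exact: measurable_cube.
apply: Lnorm_mono => // x; rewrite !patchE; case: ifP => // /set_mem ax.
by rewrite !abse_EFin lee_fin !ger0_norm ?normc_ge0//; exact: fM.
Qed.

(** A single term of the sum that defines the amalgam norm. *)
Lemma Lnorm_cube_le_amalgam p q f a : (1 <= q)%R ->
  'N[mu]_p%:E[modulus f \_ (cube a)] <= amalgam_norm p q f.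
Proof.
move=> q1; have q0 : (0 < q)%R by rewrite (lt_le_trans _ q1).
rewrite -[leLHS]poweRe1 ?Lnorm_ge0// -(divff (lt0r_neq0 q0)) poweRrM.
apply: ge0_le_poweR; [by rewrite invr_ge0 ltW|exact: poweR_ge0|].
by apply: esum_ge; exists [set a]; [split|rewrite fsbig_set1].
Qed.

(** The bound M is the same for all centres a0: translating by a lattice vector
    permutes the unit cubes. *)
Lemma amalgam_norm_decay p q (C : R) : (0 < p)%R -> (1 <= q)%R -> (0 <= C)%R ->
  exists M : R, forall f a0,
    (forall a x, cube a x -> (normc (f x) <= C * decay_rV (a - a0))%R) ->
    amalgam_norm p q f <= M%:E.
Proof.
move=> p0 q1 C0; have q0 : (0 < q)%R by rewrite (lt_le_trans _ q1).
pose S := \esum_(a in [set: 'rV[int]_d]) (@decay_rV R d a)%:E.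
have S0 : 0 <= S by apply: esum_ge0 => v _; rewrite lee_fin decay_rV_ge0.
have Sfin : S \is a fin_num by rewrite ge0_fin_numE// esum_decay_rV.
have Cq0 : (0 <= C `^ q)%R by exact: powR_ge0.
have Mfin : ((C `^ q)%:E * S) `^ q^-1 \is a fin_num.
  by apply: fin_num_poweR; rewrite -(fineK Sfin) -EFinM.
exists (fine (((C `^ q)%:E * S) `^ q^-1)) => f a0 fC.
rewrite fineK//; apply: ge0_le_poweR.
- by rewrite invr_ge0 ltW.
- by apply: esum_ge0 => a _; exact: poweR_ge0.
have bs : set_bij [set: 'rV[int]_d] [set: 'rV[int]_d] (fun a => a - a0)%R.
  split=> //.
  - by move=> a b _ _ /addIr.
  - by move=> a _; exists (a + a0)%R => //; rewrite addrK.
have -> : S = \esum_(a in [set: 'rV[int]_d]) (decay_rV (a - a0))%:E.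
  exact: reindex_esum bs.
apply: le_trans (esumZl_le _ Cq0 _); last first.
  by move=> a; rewrite lee_fin decay_rV_ge0.
apply: le_esum => a _.
have CD0 : (0 <= C * decay_rV (a - a0))%R by rewrite mulr_ge0 ?decay_rV_ge0.
apply: (@le_trans _ _ ((C * decay_rV (a - a0))%:E `^ q)).
  apply: ge0_le_poweR; [exact: ltW|exact: Lnorm_ge0|].
  by apply: Lnorm_cube_le => //; exact: fC.
rewrite poweR_EFin -EFinM lee_fin powRM ?decay_rV_ge0// ler_wpM2l//.
have D0 := @decay_rV_ge0 R d (a - a0).
(* As decay_rV is at most 1 and q >= 1, its power q is still summable. *)
have D1 : (@decay_rV R d (a - a0) <= 1)%R.
  apply: prodr_ile1 => i _; rewrite decay_ge0/=.
  by rewrite /decay exprn_ile1 ?invr_ge0// invf_le1// ler1n.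
move: D0; rewrite le_eqVlt => /predU1P[<-|D0].
  by rewrite powR0// gt_eqF.
by apply: ge1r_powR; rewrite ?D0.
Qed.

Lemma amalgam_norm_lty p q f g (C : R) : (0 < p)%R -> (1 <= q)%R -> (0 <= C)%R ->
  complex_measurable g ->
  (forall x, normc (f x) <= C * normc (g x))%R ->
  amalgam_norm p q g < +oo -> amalgam_norm p q f < +oo.
Proof.
move=> p0 q1 C0 mg fg; have q0 : (0 < q)%R by rewrite (lt_le_trans _ q1).
have Nfg a : 'N[mu]_p%:E[modulus f \_ (cube a)] <=
    C%:E * 'N[mu]_p%:E[modulus g \_ (cube a)].
  rewrite -Lnorm_scale//; last first.
    apply: (measurable_restrictT _ (measurable_cube a)).1.
    by apply: measurable_funTS; apply/measurable_EFinP; exact: measurable_modulus.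
  apply: Lnorm_mono => // x; rewrite !patchE; case: ifP => _; last first.
    by rewrite mule0.
  by rewrite -EFinM !abse_EFin lee_fin !ger0_norm ?mulr_ge0 ?normc_ge0.
have q'0 : (q^-1 != 0)%R by rewrite invr_eq0 gt_eqF.
rewrite /amalgam_norm => /(lty_poweRy q'0) goo.
have Cq0 : 0 <= (C `^ q)%:E :> \bar R by rewrite lee_fin powR_ge0.
apply: poweR_lty; apply: le_lt_trans (lte_mul_pinfty Cq0 _ goo) => //.
apply: le_trans (esumZl_le _ (powR_ge0 _ _) _); last first.
  by move=> a; exact: poweR_ge0.
apply: le_esum => a _; rewrite -poweR_EFin -poweRM ?Lnorm_ge0//.
by apply: ge0_le_poweR; [exact: ltW|exact: Lnorm_ge0|exact: Nfg].
Qed.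

End amalgam_bounds.

(** * Gaussians against weights of exponential growth *)

Section gauss_bounds.
Context {R : realType}.
Local Notation normc := ComplexField.Normc.normc.

Lemma decay_ge_exp (n : int) : expR (- `|n|%N%:R) <= decay n :> R.
Proof.
rewrite /decay expRN exprVn lef_pV2 ?posrE ?expR_gt0 ?exprn_gt0//.
rewrite -[`|n|%N%:R]mulr1 expRM_natl lerXn2r ?nnegrE ?expR_ge0//.
by apply: le_trans (expR_ge1Dx _); lra.
Qed.

(** Completing the square, - z^2 + k z <= (k + 1)^2 / 4 - z with z = |y|, and |n|
    is at most z + 1. *)
Lemma gauss_exp_decay (k : R) : 0 <= k -> exists2 C : R, 0 <= C &
  forall (n : int) y, n%:~R <= y < n%:~R + 1 ->
    gauss_fun y * expR (k * `|y|) <= C * decay n.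
Proof.
move=> k0; exists (expR ((k + 1) ^+ 2 / 4 + 1)); first exact: expR_ge0.
move=> n y ny.
have ny1 : `|n|%N%:R <= `|y| + 1 :> R.
  have -> : `|n|%N%:R = `|n%:~R| :> R by rewrite natr_absz intr_norm.
  by move: ny; case: (ger0P y) => ? /andP[? ?];
    case: (ger0P (n%:~R : R)) => ?; lra.
apply: le_trans (ler_wpM2l (expR_ge0 _) (decay_ge_exp n)).
rewrite /gauss_fun -!expRD ler_expR -(real_normK (num_real y)).
set z := `|y| in ny1 *; move: ny1; set m := _%:R => ny1.
have : 0 <= (z - (k + 1) / 2) ^+ 2 by exact: sqr_ge0.
nra.
Qed.

Lemma gauss_rV_ge0 d (a x : 'rV[R]_d) : 0 <= gauss_rV a x.
Proof. by apply: prodr_ge0 => i _; exact: gauss_fun_ge0. Qed.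

Lemma gauss_rV_le1 d (a x : 'rV[R]_d) : gauss_rV a x <= 1.
Proof. by apply: prodr_ile1 => i _; rewrite gauss_fun_ge0 gauss_fun_le1. Qed.

Lemma gauss_rV_shift d (a x : 'rV[R]_d) : gauss_rV a x = gauss_rV 0 (x - a).
Proof. by apply: eq_bigr => i _; rewrite !mxE subr0. Qed.

Lemma gauss_rV_scale_le d (c : R) (x : 'rV[R]_d) : 1 <= c ->
  gauss_rV 0 (c *: x) <= gauss_rV 0 x.
Proof.
move=> c1; apply: ler_prod => i _; rewrite gauss_fun_ge0/= !mxE !subr0.
rewrite /gauss_fun ler_expR lerN2 exprMn ler_peMl ?sqr_ge0//.
by rewrite exprn_ege1.
Qed.

Lemma gauss_rV_cube_ge d (b : 'rV[int]_d) (x : 'rV[R]_d) : cube b x ->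
  expR (-1) ^+ d <= gauss_rV (map_mx (fun n : int => n%:~R) b) x.
Proof.
move=> bx; rewrite /gauss_rV -[d in X in X <= _]card_ord -prodr_const.
apply: ler_prod => i _; rewrite expR_ge0/= !mxE /gauss_fun ler_expR lerN2.
have := bx i => ?; rewrite exprn_ile1//; lra.
Qed.

Lemma measurable_gauss_rV d (a : 'rV[R]_d) : measurable_fun setT (gauss_rV a).
Proof.
apply: measurable_prod => i _.
apply: (measurableT_comp (@measurable_gauss_fun R)).
by apply: measurable_funB => //; exact: measurable_coord_rV.
Qed.

Lemma measurable_dotv d (a : 'rV[R]_d) : measurable_fun setT (dotv a).
Proof.
apply: measurable_sum => i.
by apply: measurable_funM => //; exact: measurable_coord_rV.
Qed.

(** A Beurling weight grows at most exponentially, and a Gaussian decays faster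
    than every exponential. *)
Lemma gauss_weight_decay d (w : 'rV[R]_d -> R) : beurling_weight w ->
  exists2 C : R, 0 <= C & forall b y, cube b y ->
    gauss_rV 0 y * w y <= C * decay_rV b.
Proof.
move=> /weight_exp_bound[B [k [B1 k0 wB]]].
have [C C0 gC] := gauss_exp_decay k0.
exists (B * C ^+ d); first by rewrite mulr_ge0 ?exprn_ge0//; lra.
move=> b y by_.
apply: le_trans (ler_wpM2l (gauss_rV_ge0 _ _) (wB y)) _.
rewrite mulrCA -mulrA ler_wpM2l//; first by lra.
rewrite /gauss_rV -big_split/= /decay_rV -[d in C ^+ d]card_ord -prodr_const.
rewrite -big_split/=; apply: ler_prod => i _.
rewrite !mxE subr0 mulr_ge0 ?gauss_fun_ge0 ?expR_ge0//=.
exact: gC.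
Qed.

(** A compact set is contained in a box, and boxes have finite measure. *)
Lemma Lp_loc_bounded d p (f : 'rV[R]_d -> R[i]) (M : R) : 0 < p ->
  complex_measurable f -> (forall x, normc (f x) <= M) -> Lp_loc p f.
Proof.
move=> p0 mf fM; split=> // K /compact_bounded[N [_ KN]].
pose L : R := `|N| + 1.
have {}KN x : K x -> `|x| <= L.
  by apply: KN; rewrite /L ltr_pwDr// ler_norm.
pose Q : set 'rV[R]_d := box (fun=> - L) (2 * L + 1).
have L0 : 0 <= L by rewrite /L addr_ge0.
have M0 : 0 <= M by rewrite (le_trans _ (fM 0))// normc_ge0.
have mQ : measurable (Q : set (euclidean R d)).
  by apply: borel_sub_lebesgue; exact: measurable_box.
apply: (@le_lt_trans _ _ ('N[lebesgue_rV R d]_p%:E[(fun=> M%:E) \_ Q])%E).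
  apply: Lnorm_mono => // x; rewrite !patchE.
  case: ifPn => [/set_mem Kx|_]; last by rewrite abse0 abse_ge0.
  rewrite mem_set; last first.
    move=> i; have := le_trans (coord_norm_le x i) (KN _ Kx).
    by rewrite ler_norml => /andP[]; lra.
  by rewrite !abse_EFin lee_fin !ger0_norm ?normc_ge0.
rewrite Lnorm_cst_restrict// lebesgue_rVE; last exact: measurable_box.
rewrite borel_lebesgue_box; last by lra.
by rewrite poweR_EFin -EFinM ltry.
Qed.

End gauss_bounds.

(** * Lattice points along which a quotient of weights stays away from zero *)

Section escape.
Context {R : realType} {d : nat}.

Definition lattice_point (a : 'rV[int]_d) : 'rV[R]_d :=
  map_mx (fun n : int => n%:~R) a.

Lemma not_cvg0_escape (v w : 'rV[R]_d -> R) :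
  (forall x, 0 < w x) -> (forall x, 0 <= v x) ->
  ~ (v x / w x @[x --> nbhs_infinity] --> 0) ->
  exists2 e : R, 0 < e & forall M, exists2 x, M < `|x| & e * w x <= v x.
Proof.
move=> w0 v0 nlim; apply: contrapT => H; apply: nlim => A /nbhs_ballP[e /= e0 eA].
apply: contrapT => nA; apply: H; exists e => // M; apply: contrapT => nx.
apply: nA; exists M => x Mx; apply: eA; rewrite -ball_normE/= sub0r normrN.
rewrite ger0_norm ?divr_ge0 ?(ltW (w0 _))// ltr_pdivrMr// ltNge.
by apply/negP => ex; apply: nx; exists x.
Qed.

(** Rounding a point down to the lattice moves it by at most 1, which changes
    both weights by at most a bounded factor.  Choosing each point of norm larger
    than the previous one makes the sequence injective. *)
Lemma lattice_escape (v w : 'rV[R]_d -> R) (e : R) :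
  beurling_weight v -> beurling_weight w -> 0 < e ->
  (forall M, exists2 x, M < `|x| & e * w x <= v x) ->
  exists2 e' : R, 0 < e' & exists a : nat -> 'rV[int]_d, injective a /\
    forall n, e' * w (lattice_point (a n)) <= v (lattice_point (a n)).
Proof.
move=> bv bw e0 ev.
have [_ _ v1 vM] := bv; have [_ _ w1 wM] := bw.
have [Bv Bv1 vB] := weight_unit_bounded bv.
have [Bw Bw1 wB] := weight_unit_bounded bw.
have Bv0 : 0 < Bv by lra.
have Bw0 : 0 < Bw by lra.
(* Rounding costs a factor Bw for w and a factor Bv for v. *)
pose e' := e / (Bv * Bw).
exists e'; first by rewrite divr_gt0// mulr_gt0.
have sel (M : R) : {a : 'rV[int]_d | M < `|lattice_point a| /\
    e' * w (lattice_point a) <= v (lattice_point a)}.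
  apply: cid; have [x Mx ex] := ev (M + 1).
  pose a : 'rV[int]_d := \row_i Num.floor (x ord0 i).
  have xa : `|x - lattice_point a| <= 1.
    apply/rV_norm_leP => // i; rewrite !mxE.
    have /andP[] := floor_itv (x ord0 i).
    by rewrite ler_norml intrD => ? ?; lra.
  exists a; split.
    have := ler_normD (x - lattice_point a) (lattice_point a).
    by rewrite subrK; lra.
  have wa : w (lattice_point a) <= w x * Bw.
    rewrite -{1}(subrKC x (lattice_point a)) (le_trans (wM _ _))//.
    rewrite ler_wpM2l ?(le_trans ler01)// wB// -normrN opprB//.
  have vx : v x <= v (lattice_point a) * Bv.
    rewrite -{1}(subrKC (lattice_point a) x) (le_trans (vM _ _))//.
    by rewrite ler_wpM2l ?(le_trans ler01)// vB.
  rewrite /e' mulrAC ler_pdivrMr ?mulr_gt0// mulrA.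
  apply: (@le_trans _ _ (e * (w x * Bw))); first by rewrite ler_wpM2l// ltW.
  rewrite mulrA; apply: ler_wpM2r; first exact: ltW.
  exact: le_trans vx.
pose a := fix a n := if n is n'.+1 then sval (sel `|lattice_point (a n')|)
  else sval (sel 0).
exists a; split; last by case=> [|n] /=; case: (sel _) => ? [].
have aS n : `|lattice_point (a n)| < `|lattice_point (a n.+1)|.
  by rewrite /=; case: (sel _) => ? [].
have amono : {homo a : m n / (m < n)%N >-> `|lattice_point m| < `|lattice_point n|}.
  apply: (homo_ltn (r := fun m n => `|lattice_point m| < `|lattice_point n|)) => //.
  by move=> x y z; exact: lt_trans.
by move=> m n amn; case: (ltngtP m n) => // /amono; rewrite amn ltxx.
Qed.

End escape.

(** * The triangle inequality on a cube and divergence of sums *)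

Section amalgam_more.
Context {R : realType} {d : nat}.
Local Notation mu := (lebesgue_rV R d).
Local Notation normc := ComplexField.Normc.normc.
Implicit Types (f g : 'rV[R]_d -> R[i]) (p q : R).

Lemma complex_measurableB f g : complex_measurable f -> complex_measurable g ->
  complex_measurable (f - g).
Proof.
have E x : (f - g) x = Complex (complex.Re (f x) - complex.Re (g x))
    (complex.Im (f x) - complex.Im (g x)).
  by rewrite !fctE; case: (f x) => ? ?; case: (g x).
move=> [f1 f2] [g1 g2]; split; rewrite /lebesgue_measurable.
  by under eq_fun do rewrite E /=; exact: measurable_funB.
by under eq_fun do rewrite E /=; exact: measurable_funB.
Qed.

Lemma Lnorm_cube_triangle p f g h a : 1 <= p ->
  complex_measurable f -> complex_measurable g ->
  (forall x, h x = f x + g x) ->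
  ('N[mu]_p%:E[modulus h \_ (cube a)] <=
   'N[mu]_p%:E[modulus f \_ (cube a)] + 'N[mu]_p%:E[modulus g \_ (cube a)])%E.
Proof.
move=> p1 mf mg hE.
have p0 : 0 < p by lra.
pose rest f : euclidean R d -> R := (fun x => normc (f x)) \_ (cube a).
have restE f' : modulus f' \_ (cube a) = EFin \o rest f'.
  by apply/funext => x; rewrite /rest /modulus /= !patchE; case: ifP.
have mrest f' : complex_measurable f' -> measurable_fun setT (rest f').
  move=> mf'; apply: (measurable_restrictT _ (measurable_cube a)).1.
  by apply: measurable_funTS; exact: measurable_modulus.
have rest0 f' x : 0 <= rest f' x.
  by rewrite /rest patchE; case: ifP => // _; exact: normc_ge0.
rewrite !restE.
apply: le_trans (minkowski_EFin mu (mrest _ mf) (mrest _ mg) p1).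
apply: Lnorm_mono => // x; rewrite !abse_EFin lee_fin.
rewrite [leRHS]ger0_norm; last by rewrite addr_ge0.
rewrite ger0_norm// /rest /= !patchE; case: ifP => _; last by rewrite addr0.
rewrite hE; exact: le_normcD.
Qed.

Lemma esum_injective_eqy (T : choiceType) (b : T -> \bar R) (e : nat -> T) (c : R) :
  injective e -> 0 < c -> (forall t, 0 <= b t)%E -> (forall n, c%:E <= b (e n))%E ->
  \esum_(t in [set: T]) b t = +oo%E.
Proof.
move=> ie c0 b0 cb.
have : (\esum_(n in [set: nat]) c%:E <= \esum_(t in [set: T]) b t)%E.
  apply: (@le_trans _ _ (\esum_(t in e @` setT) b t)).
    rewrite esum_image; last by move=> m n _ _; exact: ie.
    by apply: le_esum => n _; exact: cb.
  rewrite esum_mkcond; apply: le_esum => t _.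
  by case: ifP.
rewrite -nneseries_esumT; last by move=> n; rewrite lee_fin ltW.
set S := \esum_(t in _) _ => cS.
apply/eqyP => A A0; apply: le_trans cS.
have [n An] : exists n : nat, A / c <= n%:R.
  by exists (Num.truncn (A / c)).+1; exact/ltW/truncnS_gt.
apply: (@le_trans _ _ (\sum_(0 <= i < n) c%:E)%E).
  rewrite sumEFin lee_fin sumr_const_nat subn0 -mulr_natl.
  by rewrite -ler_pdivrMr.
by apply: nneseries_lim_ge => i _ _; rewrite lee_fin ltW.
Qed.

End amalgam_more.

(** * Translated Gaussians in the weighted spaces *)

Section gauss_in_A_space.
Context {R : realType} {d : nat}.
Local Notation normc := ComplexField.Normc.normc.

Definition gauss_wave (c : R) (a : 'rV[R]_d) (x : 'rV[R]_d) : R[i] :=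
  real_complex R (c * gauss_rV a x).

Lemma normc_cis (t : R) : normc (cis t) = 1.
Proof. by rewrite /cis /= sqrrN cos2Dsin2 sqrtr1. Qed.

Lemma gauss_mass_ge0 : 0 <= gauss_mass :> R.
Proof. by apply: Rintegral_ge0 => x _; exact: gauss_fun_ge0. Qed.

Lemma normc_gauss_wave c a x : 0 <= c ->
  normc (gauss_wave c a x) = c * gauss_rV a x.
Proof. by move=> c0; rewrite normc_real ger0_norm// mulr_ge0 ?gauss_rV_ge0. Qed.

Lemma normc_fourier_gauss_wave c a xi : 0 <= c ->
  normc (fourier (gauss_wave c a) xi) =
  c * gauss_mass ^+ d * gauss_rV 0 (pi *: xi).
Proof.
move=> c0; rewrite fourier_gauss_rV ComplexField.Normc.normcM normc_cis mulr1.
rewrite normc_real ger0_norm//.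
by rewrite !mulr_ge0 ?exprn_ge0 ?gauss_mass_ge0 ?gauss_rV_ge0.
Qed.

Lemma complex_measurable_gauss_wave c a : complex_measurable (gauss_wave c a).
Proof.
split; apply: borel_lebesgue_measurable.
  by apply: measurable_funM => //; exact: measurable_gauss_rV.
exact: measurable_cst.
Qed.

Lemma complex_measurable_fourier_gauss_wave c a :
  complex_measurable (fourier (gauss_wave c a)).
Proof.
have mg : measurable_fun setT (fun xi : 'rV[R]_d =>
    c * gauss_mass ^+ d * gauss_rV 0 (pi *: xi)).
  apply: measurable_funM => //.
  apply: (measurableT_comp (measurable_gauss_rV 0)).
  apply: measurable_fun_rV => i; under eq_fun do rewrite mxE.
  by apply: measurable_funM => //; exact: measurable_coord_rV.
have mp : measurable_fun setT (fun xi : 'rV[R]_d => 2 * pi * dotv a xi).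
  by apply: measurable_funM => //; exact: measurable_dotv.
split; apply: borel_lebesgue_measurable.
- under eq_fun do rewrite fourier_gauss_rV ReM /= mul0r subr0.
  apply: measurable_funM => //.
  exact: (measurableT_comp (continuous_measurable_fun (@continuous_cos R))).
- under eq_fun do rewrite fourier_gauss_rV ImM /= mul0r addr0.
  apply: measurable_funM => //; apply: measurable_funN.
  exact: (measurableT_comp (continuous_measurable_fun (@continuous_sin R))).
Qed.

(** On the function side, w1 x <= w1 A * w1 (x - A), where A is the centre, and
    the factor w1 A is cancelled by the normalisation.  On the Fourier side the
    normalisation is at most 1 and the modulus of the transform does not depend
    on A. *)
Lemma gauss_wave_bounded (p q r : R) (w1 w2 : 'rV[R]_d -> R) :
  1 <= p -> 1 <= q -> 1 <= r -> beurling_weight w1 -> beurling_weight w2 ->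
  exists M : R, forall a : 'rV[int]_d,
    let u := gauss_wave (w1 (lattice_point a))^-1 (lattice_point a) in
    A_space p q r w1 w2 u /\ (A_norm p q r w1 w2 u <= M%:E)%E.
Proof.
move=> p1 q1 r1 b1 b2.
have p0 : 0 < p by lra.
have q0 : 0 < q by lra.
have [_ _ w1_ge1 w1M] := b1; have [_ _ w2_ge1 _] := b2.
have w1_gt0 x : 0 < w1 x by exact: lt_le_trans (w1_ge1 x).
have w2_ge0 x : 0 <= w2 x by exact: le_trans (w2_ge1 x).
have [C1 C10 decay1] := gauss_weight_decay b1.
have [C2 C20 decay2] := gauss_weight_decay b2.
have K0 : 0 <= gauss_mass ^+ d :> R by rewrite exprn_ge0// gauss_mass_ge0.
have [M1 HM1] := @amalgam_norm_decay R d p 1 C1 p0 (lexx _) C10.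
have [M2 HM2] := @amalgam_norm_decay R d q r (gauss_mass ^+ d * C2) q0 r1
  (mulr_ge0 K0 C20).
exists (M1 + M2) => a; set A := lattice_point a; set c := (w1 A)^-1; move=> u.
have c0 : 0 <= c by rewrite invr_ge0 ltW.
have c1 : c <= 1 by rewrite invf_le1.
have N1 : (weighted_amalgam_norm p 1 w1 u <= M1%:E)%E.
  apply: (HM1 _ a) => b x bx; rewrite modulus_weight ?(ltW (w1_gt0 _))//.
  rewrite normc_gauss_wave// gauss_rV_shift.
  apply: le_trans (decay1 (b - a) (x - A) _); last first.
    by move=> i; have := bx i; rewrite !mxE intrB => /andP[? ?]; apply/andP; lra.
  rewrite -mulrA mulrCA ler_wpM2l ?gauss_rV_ge0//.
  by rewrite /c mulrC ler_pdivrMr// -{1}(subrK A x).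
have N2 : (weighted_amalgam_norm q r w2 (fourier u) <= M2%:E)%E.
  apply: (HM2 _ 0) => b x bx; rewrite modulus_weight// subr0.
  rewrite normc_fourier_gauss_wave// -!mulrA.
  apply: (@le_trans _ _ (1 * (gauss_mass ^+ d * (gauss_rV 0 x * w2 x)))).
    apply: ler_pM => //; first by rewrite !mulr_ge0 ?gauss_rV_ge0.
    apply: ler_wpM2l => //; apply: ler_wpM2r => //.
    by apply: gauss_rV_scale_le; rewrite (le_trans _ (pi_ge2 R))// ler1n.
  by rewrite mul1r; apply: ler_wpM2l => //; exact: decay2.
split; last by rewrite EFinD leeD.
split; split.
- apply: (Lp_loc_bounded (M := 1)) => //.
    exact: complex_measurable_gauss_wave.
  by move=> x; rewrite normc_gauss_wave// mulr_ile1 ?gauss_rV_ge0 ?gauss_rV_le1.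
- by rewrite (le_lt_trans N1)// ltry.
- apply: (Lp_loc_bounded (M := gauss_mass ^+ d)) => //.
    exact: complex_measurable_fourier_gauss_wave.
  move=> x; rewrite normc_fourier_gauss_wave// mulrAC ler_piMl//.
  by rewrite mulr_ile1 ?gauss_rV_ge0 ?gauss_rV_le1.
- by rewrite (le_lt_trans N2)// ltry.
Qed.

(** On the unit cube at A the Gaussian is at least exp (- d), and w3 is at least
    w3 A / B, where B bounds w3 on the unit ball. *)
Lemma gauss_wave_cube_ge (p : R) (w1 w3 : 'rV[R]_d -> R) (e : R) :
  0 < p -> beurling_weight w1 -> beurling_weight w3 -> 0 < e ->
  exists2 c : R, 0 < c & forall a : 'rV[int]_d,
    e * w1 (lattice_point a) <= w3 (lattice_point a) ->
    (c%:E <= 'N[lebesgue_rV R d]_p%:E[modulus (fun x =>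
      (gauss_wave (w1 (lattice_point a))^-1 (lattice_point a) x *
        real_complex R (w3 x))%R) \_ (cube a)])%E.
Proof.
move=> p0 b1 b3 e0.
have [_ _ w1_ge1 _] := b1; have [_ _ w3_ge1 w3M] := b3.
have w1_gt0 x : 0 < w1 x by exact: lt_le_trans (w1_ge1 x).
have w3_ge0 x : 0 <= w3 x by exact: le_trans (w3_ge1 x).
have [B B1 w3B] := weight_unit_bounded b3.
have B0 : 0 < B by lra.
pose c := expR (-1) ^+ d * (e / B).
have c0 : 0 < c by rewrite mulr_gt0 ?exprn_gt0 ?expR_gt0// divr_gt0.
exists c => // a ea; apply: Lnorm_cube_ge => //; first exact: ltW.
set A := lattice_point a in ea *.
move=> x ax; rewrite modulus_weight// normc_gauss_wave ?invr_ge0 ?(ltW (w1_gt0 _))//.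
rewrite (mulrC _ (gauss_rV _ _)) -mulrA /c; apply: ler_pM.
- by rewrite exprn_ge0// expR_ge0.
- by rewrite divr_ge0// ltW.
- exact: gauss_rV_cube_ge.
rewrite [leRHS]mulrC ler_pdivlMr// mulrAC ler_pdivrMr//.
apply: le_trans ea _; rewrite -{1}(subrKC x A) (le_trans (w3M _ _))//.
rewrite ler_wpM2l// w3B//; apply/rV_norm_leP => // i.
by have := ax i; rewrite !mxE ler_norml => /andP[? ?]; apply/andP; lra.
Qed.

Lemma A_space_sub (p q r : R) (w1 w2 w3 w4 : 'rV[R]_d -> R) :
  1 <= p -> 1 <= q -> 1 <= r ->
  beurling_weight w1 -> beurling_weight w2 ->
  beurling_weight w3 -> beurling_weight w4 ->
  weight_le w3 w1 -> weight_le w4 w2 ->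
  A_space p q r w1 w2 `<=` A_space p q r w3 w4.
Proof.
have sub (s t : R) (v w : 'rV[R]_d -> R) : 1 <= s -> 1 <= t ->
    beurling_weight v -> beurling_weight w -> weight_le v w ->
    weighted_amalgam s t w `<=` weighted_amalgam s t v.
  move=> s1 t1 bv bw [C C0 vw] f [floc fw]; split => //.
  have [_ _ v_ge1 _] := bv; have [mw _ w_ge1 _] := bw.
  apply: amalgam_norm_lty fw.
  - by lra.
  - by [].
  - exact: ltW C0.
  - by apply: complex_measurableM => //; have [] := floc.
  move=> x; rewrite !modulus_weight ?(le_trans ler01)//.
  by rewrite mulrCA ler_wpM2l ?normc_ge0.
move=> p1 q1 r1 b1 b2 b3 b4 w31 w42 f [f1 f2]; split.
- exact: sub f1.
- exact: sub f2.
Qed.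

(** The limit g of a subsequence would carry a fixed amount of L^p mass on
    infinitely many distinct cubes, so that its amalgam norm would be infinite. *)
Lemma not_compact_of_escape (p q r : R) (w1 w2 w3 w4 : 'rV[R]_d -> R) (e : R) :
  1 <= p -> 1 <= q -> 1 <= r ->
  beurling_weight w1 -> beurling_weight w2 -> beurling_weight w3 -> 0 < e ->
  (forall M, exists2 x, M < `|x| & e * w1 x <= w3 x) ->
  ~ compact_inclusion (A_space p q r w1 w2) (A_space p q r w3 w4)
      (A_norm p q r w1 w2) (A_norm p q r w3 w4).
Proof.
move=> p1 q1 r1 b1 b2 b3 e0 esc cpt.
have p0 : 0 < p by lra.
have [e' e'0 [a [inja ea]]] := lattice_escape b3 b1 e0 esc.
have [M HM] := gauss_wave_bounded p1 q1 r1 b1 b2.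
pose u n := gauss_wave (w1 (lattice_point (a n)))^-1 (lattice_point (a n)).
have [|k kS [g Yg ug]] := cpt u (fun n => (HM (a n)).1).
  by exists M => n; exact: (HM (a n)).2.
have [c c0 Hc] := gauss_wave_cube_ge p0 b1 b3 e'0.
have [[mg _] gfin] := Yg.1.
have mw3 : lebesgue_measurable w3 by have [] := b3.
pose G b := 'N[lebesgue_rV R d]_p%:E[modulus (fun x => g x * real_complex R (w3 x))%R
  \_ (cube b)]%E.
have [N _ HN] : \forall n \near \oo,
    (A_norm p q r w3 w4 (u (k n) - g)%R < (c / 2)%:E)%E.
  apply: (ug [set y | (y < (c / 2)%:E)%E]).
  by apply: open_ereal_lt'; rewrite lte_fin divr_gt0.
have Glow n : ((c / 2)%:E <= G (a (k (n + N)%N)))%E.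
  set m := k _.
  have small : ('N[lebesgue_rV R d]_p%:E[modulus (fun x => (u m - g) x *
      real_complex R (w3 x))%R \_ (cube (a m))] < (c / 2)%:E)%E.
    apply: le_lt_trans (HN (n + N)%N (leq_addl _ _)).
    apply: le_trans (Lnorm_cube_le_amalgam p _ (a m) (lexx 1)) _.
    by rewrite leeDl// poweR_ge0.
  have mum : complex_measurable (u m - g).
    exact: complex_measurableB (complex_measurable_gauss_wave _ _) mg.
  have tri : (c%:E <= 'N[lebesgue_rV R d]_p%:E[modulus (fun x => (u m - g) x *
      real_complex R (w3 x))%R \_ (cube (a m))] + G (a m))%E.
    apply: le_trans (Hc _ (ea m)) _.
    apply: Lnorm_cube_triangle => //; try exact: complex_measurableM.
    by move=> x; rewrite !fctE mulrBl subrK.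
  rewrite leNgt; apply/negP => Gc.
  have := le_lt_trans tri (lteD small Gc).
  by rewrite -EFinD -splitr ltxx.
have : (\esum_(b in setT) G b)%E = +oo%E.
  apply: (esum_injective_eqy (e := fun n => a (k (n + N)%N)) _ (c := c / 2)) => //.
  - move=> i j /inja kij.
    case: (ltngtP (i + N)%N (j + N)%N) => [/kS|/kS|/addIn//];
      by rewrite kij ltnn.
  - by rewrite divr_gt0.
  - by move=> b; exact: Lnorm_ge0.
move=> Ginf; move: gfin; rewrite /weighted_amalgam_norm /amalgam_norm.
rewrite invr1 poweRe1; last by apply: esum_ge0 => b _; exact: poweR_ge0.
under eq_esum => b _ do rewrite poweRe1 ?Lnorm_ge0//.
by rewrite [X in (X < _)%E]Ginf.
Qed.

End gauss_in_A_space.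

Theorem theorem17 (R : realType) (d : nat) (p q r : R)
    (w1 w2 w3 w4 : 'rV[R]_d -> R) :
  1 <= p -> 1 <= q -> 1 <= r ->
  beurling_weight w1 -> beurling_weight w2 ->
  beurling_weight w3 -> beurling_weight w4 ->
  [/\ weight_le w4 w2, weight_le w2 w1, weight_le w3 w1 &
      ~ (w3 x / w1 x @[x --> nbhs_infinity] --> 0)] \/
  [/\ weight_le w3 w1, weight_le w1 w2, weight_le w4 w2 &
      ~ (w3 x / w2 x @[x --> nbhs_infinity] --> 0)] ->
  A_space p q r w1 w2 `<=` A_space p q r w3 w4 /\
  ~ compact_inclusion (A_space p q r w1 w2) (A_space p q r w3 w4)
      (A_norm p q r w1 w2) (A_norm p q r w3 w4).
Proof.
move=> p1 q1 r1 b1 b2 b3 b4 H.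
have pos w : beurling_weight w -> forall x : 'rV[R]_d, 0 < w x.
  by move=> [_ _ w_ge1 _] x; exact: lt_le_trans (w_ge1 x).
have nneg x : 0 <= w3 x by exact/ltW/pos.
case: H => [[w42 _ w31 nlim]|[w31 [C C0 w12] w42 nlim]].
  split; first exact: A_space_sub.
  have [e e0 He] := not_cvg0_escape (pos _ b1) nneg nlim.
  exact: not_compact_of_escape He.
split; first exact: A_space_sub.
have [e e0 He] := not_cvg0_escape (pos _ b2) nneg nlim.
apply: (@not_compact_of_escape _ _ _ _ _ _ _ _ _ (e / C)) => //.
  by rewrite divr_gt0.
move=> M; have [x Mx ex] := He M; exists x => //.
apply: le_trans ex; rewrite -mulrA ler_wpM2l ?(ltW e0)//.
by rewrite mulrC ler_pdivrMr// mulrC.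
Qed.
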